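(* Let $k=3$, $l=2$ and let $X\subset\mathcal{C}_3$ be an ideal of colorings. Then there is a constant $c>0$ such that either $|X_n|\le n^c$ for every $n\in\mathbb{N}$, or $|X_n|\ge G_n$ for every $n\ge 23$.
   Context: $\mathbb{N}=\{1,2,\dots\}$ and $[n]=\{1,2,\dots,n\}$; $\binom{A}{3}$ is the set of $3$-element subsets of $A$. A coloring is a pair $(n,\chi)$ with $n\in\mathbb{N}$ and $\chi:\binom{[n]}{3}\to[2]$ any map (the empty map for $n<3$); $\mathcal{C}_3$ is the set of all colorings. For colorings, $(m,\phi)\preceq(n,\chi)$ means that there is an increasing injection $f:[m]\to[n]$ such that $\phi(E)=\chi(f(E))$ for every $E\in\binom{[m]}{3}$. A set $X\subset\mathcal{C}_3$ is an ideal if $K\preceq L\in X$ implies $K\in X$. $X_n$ is the set of those colorings in $X$ that have the vertex set $[n]$. The sequence $(G_n)_{n\ge1}$ is defined by $G_1=G_2=1$, $G_3=2$ and $G_n=G_{n-1}+G_{n-3}$ for $n\ge4$. *)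

(* Defs.v *)
From HB Require Import structures.
From mathcomp Require Import all_boot all_order all_algebra.
From mathcomp Require Import all_classical all_reals exp.

Set Implicit Arguments.
Unset Strict Implicit.
Unset Printing Implicit Defensive.

Local Open Scope nat_scope.

(* The vertex set [n] = {1, ..., n} is represented by the ordered set
   'I_n = {0, ..., n-1}, and the set of colors [2] by 'I_2. *)

Definition triple (n : nat) := {E : {set 'I_n} | #|E| == 3}.

Definition coloring_on (n : nat) := {ffun triple n -> 'I_2}.

Definition coloring := {n : nat & coloring_on n}.

(* The type [coloring] also contains the empty map on the empty vertex set;
   it is excluded here, since n ranges over {1, 2, ...}. *)
Definition C3 : set coloring := fun K => 0 < tag K.

Lemma card_imset_triple (m n : nat) (f : 'I_m -> 'I_n) (f_inj : injective f)
  (E : triple m) : #|f @: val E| == 3.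
Proof. by rewrite card_imset //; exact: valP E. Qed.

Definition im_triple (m n : nat) (f : 'I_m -> 'I_n) (f_inj : injective f)
    (E : triple m) : triple n :=
  exist _ (f @: val E) (card_imset_triple f_inj E).

Definition contained (K L : coloring) : Prop :=
  exists (f : 'I_(tag K) -> 'I_(tag L)) (f_inj : injective f),
    (forall i j : 'I_(tag K), i < j -> f i < f j) /\
    (forall E : triple (tag K), tagged K E = tagged L (im_triple f_inj E)).

Definition ideal (X : set coloring) : Prop :=
  (forall K, X K -> C3 K) /\
  (forall K L, C3 K -> contained K L -> X L -> X K).

Definition slice (X : set coloring) (n : nat) : {set coloring_on n} :=
  finset (fun chi : coloring_on n => `[< X (Tagged coloring_on chi) >]).

(* The value at 0 is a dummy: the sequence starts at n = 1. *)
Fixpoint G (n : nat) : nat :=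
  match n with
  | 0 => 0
  | 1 => 1
  | 2 => 1
  | 3 => 2
  | (k.+2 as p).+1 => G p + G k
  end.

(* Main.v *)
Require Import Defs.
From mathcomp Require Import all_boot all_order all_algebra.
From mathcomp Require Import all_classical all_reals exp.
From mathcomp Require Import zify.

(* Call i a break of a coloring if swapping i and i+1 changes the color of some
   triple {i, a, b}.  A coloring is determined by its breaks and by the colors of
   the triples of intervals between them, so if the number of breaks is bounded
   on X then |X_n| is polynomially bounded.

   Now fix n >= 23 with |X_n| < G_n and suppose that some coloring in X has many
   breaks, giving many blocks (x, x', a, b) in which the pair {a, b} tells x and
   x' apart.  By Ramsey's theorem we may assume that the order and the colors of
   the vertices only depend on their slots and on the relative order of the
   blocks.  One shows in turn that the blocks cannot share both a and b, cannot
   share a, and cannot exist at all, each time by exhibiting G_n colorings in X_n: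
   - if a and b are shared, choosing x or x' in n-2 blocks gives 2^(n-2) of them;
   - if a is shared, the link of a contains, by the first step, a matching or a
     half graph, and the tilings of n-1 positions by tiles of length 1 and 2 give
     distinct colorings;
   - otherwise, by the second step, all triples of vertices that are not contained
     in a block have a color depending only on their slots up to clusters, while
     x, a, b or x', a, b in one block has the opposite color; the G_n tilings of n
     positions by tiles of length 1 and 3 (one vertex of a block, or the three of
     them) give distinct colorings. *)

Set Implicit Arguments.
Unset Strict Implicit.
Unset Printing Implicit Defensive.
Local Open Scope nat_scope.

(** * Ramsey's theorem and canonical blocks *)

Section Ramsey.
Variable C : finType.

Lemma majority (col : nat -> C) (M : nat) (s : seq nat) :
  #|C| * M < size s -> exists t, M <= count (fun x => col x == t) s.
Proof.
move=> hs; apply/not_existsP => h.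
have : size s <= \sum_(t : C) count (fun x => col x == t) s.
  elim: s {hs h} => [|x s IH] //=; rewrite big_split /=.
  by rewrite (bigD1 (col x)) //= eqxx -addnA add1n ltnS (leq_trans IH) ?leq_addl.
have : \sum_(t : C) count (fun x => col x == t) s <= \sum_(t : C) M.
  by apply: leq_sum => t _; have /negP := h t; rewrite -ltnNge => /ltnW.
by rewrite sum_nat_const => h1 h2; move: (leq_trans h2 h1); rewrite leqNgt hs.
Qed.

Lemma ramsey (r M : nat) : exists M', forall (s : seq nat) (f : seq nat -> C),
  uniq s -> M' <= size s ->
  exists s' t, [/\ subseq s' s, size s' = M &
    forall u, subseq u s' -> size u = r -> f u = t].
Proof.
elim: r M => [|r IHr] M.
  exists M => s f us hs; exists (take M s), (f [::]); split.
  - exact: take_subseq.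
  - by rewrite size_takel.
  - by move=> u _ /size0nil ->.
have pre L : exists M', forall (s : seq nat) (f : seq nat -> C),
    uniq s -> M' <= size s -> exists s' col, [/\ subseq s' s, size s' = L &
    forall x u, subseq (x :: u) s' -> size u = r -> f (x :: u) = col x].
  elim: L => [|L [ML IHL]].
    exists 1 => s f us hs; exists [::], (fun=> f [::]); split; first exact: sub0seq.
      by [].
    by move=> x u /= /eqP.
  have [M1 HM1] := IHr ML; exists M1.+1 => -[|x s] f //= /andP[xs us] hs.
  have [s2 [t [s2s zs2 Hs2]]] := HM1 s (fun u => f (x :: u)) us hs.
  have us2 := subseq_uniq s2s us.
  have [|s3 [col [s3s zs3 Hs3]]] := IHL s2 f us2 _; first by rewrite zs2.
  have s3s1 := subseq_trans s3s s2s.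
  exists (x :: s3), (fun y => if y == x then t else col y); split.
  - by rewrite /= eqxx.
  - by rewrite /= zs3.
  - move=> y u /= hy zu; case: eqP hy => [->|yx] hy.
      by apply: Hs2 => //; apply: subseq_trans s3s.
    exact: Hs3.
have [M' HM'] := pre (#|C| * M).+1.
exists M' => s f us hs; have [s1 [col [s1s zs1 Hs1]]] := HM' s f us hs.
have [|t Ht] := @majority col M s1; first by rewrite zs1.
set p := fun x => _ in Ht.
have sub : subseq (take M (seq.filter p s1)) (seq.filter p s1) by exact: take_subseq.
have sub1 : subseq (take M (seq.filter p s1)) s1.
  exact: subseq_trans sub (filter_subseq _ _).
exists (take M (seq.filter p s1)), t; split.
- exact: subseq_trans s1s.
- by rewrite size_takel // size_filter.
- move=> [|x u] // su [zu].
  rewrite (Hs1 x u) //; last exact: subseq_trans su sub1.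
  have /(mem_subseq su)/(mem_subseq sub) : x \in x :: u by rewrite inE eqxx.
  by rewrite mem_filter => /andP[/eqP].
Qed.

End Ramsey.

(* Vertices of blocks are indexed by a block number and one of four slots;
   [canonical_on] says that the order and the colors of the vertices only depend on
   the slots and on the relative order of the block numbers. *)
Definition same_order (a b a' b' : nat) :=
  ((a < b) = (a' < b')) /\ ((b < a) = (b' < a')).

Definition canonical_on (V : nat -> nat -> nat) (col : nat -> nat -> nat -> bool)
    (M : nat) : Prop :=
  (forall a b a' b' s t, a < M -> b < M -> a' < M -> b' < M -> s < 4 -> t < 4 ->
     same_order a b a' b' -> (V a s < V b t) = (V a' s < V b' t)) /\
  (forall a b c a' b' c' s t r, a < M -> b < M -> c < M ->
     a' < M -> b' < M -> c' < M -> s < 4 -> t < 4 -> r < 4 ->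
     same_order a b a' b' -> same_order b c b' c' -> same_order a c a' c' ->
     col (V a s) (V b t) (V c r) = col (V a' s) (V b' t) (V c' r)).

Lemma canonical_blocks (M : nat) : exists M', forall V col, exists g,
  [/\ forall i, i < M -> g i < M', forall i j, i < j -> j < M -> g i < g j
    & canonical_on (fun j => V (g j)) col M].
Proof.
pose W := ('I_3 * 'I_4)%type.
have [M' HM'] := ramsey ({ffun W * W -> bool} * {ffun W * W * W -> bool})%type 3 M.+2.
exists M' => V col.
pose v (u : seq nat) (w : W) := V (nth 0 u w.1) w.2.
pose f (u : seq nat) := ([ffun w : W * W => v u w.1 < v u w.2],
  [ffun w : W * W * W => col (v u w.1.1) (v u w.1.2) (v u w.2)]).
have [|s [t [ss zs Hs]]] := HM' (iota 0 M') f (iota_uniq _ _); first by rewrite size_iota.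
have srt : sorted ltn s by apply: subseq_sorted ss (iota_ltn_sorted _ _); exact: ltn_trans.
pose g i := nth 0 s i.
have gM i : i < M.+2 -> g i < M'.
  by rewrite -zs => /(mem_nth 0)/(mem_subseq ss); rewrite mem_iota.
have gS i j : i < j -> j < M.+2 -> g i < g j.
  move=> ij jM; apply: (sorted_ltn_nth ltn_trans) => //; rewrite inE zs //.
  exact: ltn_trans jM.
have ft i j k : i < j -> j < k -> k < M.+2 -> f [:: g i; g j; g k] = t.
  move=> ij jk kM; apply: Hs => //.
  have -> : [:: g i; g j; g k] = map g [:: i; j; k] by [].
  have -> : s = map g (iota 0 M.+2) by rewrite -zs map_nth_iota0 // take_size.
  apply: map_subseq; set u := [:: i; j; k].
  have -> : u = seq.filter (mem u) (iota 0 M.+2).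
    apply: (irr_sorted_eq ltn_trans ltnn); first by rewrite /= ij jk.
      exact: sorted_filter ltn_trans _ _ (iota_ltn_sorted _ _).
    move=> x; rewrite mem_filter mem_iota /= !inE; lia.
  exact: filter_subseq.
have colE i j k i' j' k' (al be ga : 'I_3) (a b c : nat) : a < 4 -> b < 4 -> c < 4 ->
    i < j -> j < k -> k < M.+2 -> i' < j' -> j' < k' -> k' < M.+2 ->
    col (V (nth 0 [:: g i; g j; g k] al) a) (V (nth 0 [:: g i; g j; g k] be) b)
        (V (nth 0 [:: g i; g j; g k] ga) c) =
    col (V (nth 0 [:: g i'; g j'; g k'] al) a) (V (nth 0 [:: g i'; g j'; g k'] be) b)
        (V (nth 0 [:: g i'; g j'; g k'] ga) c).
  move=> a4 b4 c4 ij jk kM ij' jk' kM'.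
  have := ft i j k ij jk kM; rewrite -(ft i' j' k') // => -[_ /ffunP].
  by move/(_ ((al, Ordinal a4), (be, Ordinal b4), (ga, Ordinal c4))); rewrite !ffunE.
have ordE i j k i' j' k' (al be : 'I_3) (a b : nat) : a < 4 -> b < 4 ->
    i < j -> j < k -> k < M.+2 -> i' < j' -> j' < k' -> k' < M.+2 ->
    (V (nth 0 [:: g i; g j; g k] al) a < V (nth 0 [:: g i; g j; g k] be) b) =
    (V (nth 0 [:: g i'; g j'; g k'] al) a < V (nth 0 [:: g i'; g j'; g k'] be) b).
  move=> a4 b4 ij jk kM ij' jk' kM'.
  have := ft i j k ij jk kM; rewrite -(ft i' j' k') // => -[/ffunP + _].
  by move/(_ ((al, Ordinal a4), (be, Ordinal b4))); rewrite !ffunE.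
pose o0 : 'I_3 := @Ordinal 3 0 isT; pose o1 : 'I_3 := @Ordinal 3 1 isT.
pose o2 : 'I_3 := @Ordinal 3 2 isT.
exists g; split; [by move=> i iM; apply: gM; lia|by move=> i j ij jM; apply: gS; lia|split].
- move=> a b a' b' x y aM bM a'M b'M x4 y4 [].
  case: (ltngtP a b) => ab h1 h2; move/esym: h1; move/esym: h2.
  + by move=> _ ab'; apply: (ordE a b M a' b' M o0 o1); lia.
  + by move=> ab' _; apply: (ordE b a M b' a' M o1 o0); lia.
  + move=> h1 h2; have <- : a' = b' by lia.
    by rewrite -ab; apply: (ordE a M M.+1 a' M M.+1 o0 o0); lia.
- move=> a b c a' b' c' x y z aM bM cM a'M b'M c'M x4 y4 z4 [p1 p2] [q1 q2] [r1 r2].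
  move: p1 p2 q1 q2 r1 r2.
  case: (ltngtP a b) => ab; case: (ltngtP b c) => bc; case: (ltngtP a c) => ac;
    try lia; move=> /esym h1 /esym h2 /esym h3 /esym h4 /esym h5 /esym h6.
  + by apply: (colE a b c a' b' c' o0 o1 o2); lia.
  + by apply: (colE a c b a' c' b' o0 o2 o1); lia.
  + by apply: (colE c a b c' a' b' o1 o2 o0); lia.
  + have <- : a' = c' by lia.
    by rewrite -ac; apply: (colE a b M a' b' M o0 o1 o0); lia.
  + have <- : b' = c' by lia.
    by rewrite -bc; apply: (colE a b M a' b' M o0 o1 o1); lia.
  + by apply: (colE b a c b' a' c' o1 o0 o2); lia.
  + by apply: (colE b c a b' c' a' o2 o0 o1); lia.
  + have <- : a' = c' by lia.
    by rewrite -ac; apply: (colE b a M b' a' M o1 o0 o1); lia.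
  + by apply: (colE c b a c' b' a' o2 o1 o0); lia.
  + have <- : b' = c' by lia.
    by rewrite -bc; apply: (colE b a M b' a' M o1 o0 o0); lia.
  + have <- : a' = b' by lia.
    by rewrite -ab; apply: (colE a c M a' c' M o0 o0 o1); lia.
  + have <- : a' = b' by lia.
    by rewrite -ab; apply: (colE c a M c' a' M o1 o1 o0); lia.
  + have <- : a' = b' by lia. have <- : a' = c' by lia.
    by rewrite -ac -ab; apply: (colE a M M.+1 a' M M.+1 o0 o0 o0); lia.
Qed.

(** * Tilings *)

Definition tiling (m n : nat) (z : seq bool) : Prop :=
  size z = n /\ forall i, nth false z i ->
    i + m <= n /\ forall o, 0 < o < m -> nth false z (i + o) = false.

Lemma tilings (m : nat) (f : nat -> nat) : 0 < m -> f 0 <= 1 ->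
  (forall n, f n.+1 <= f n + (if m <= n.+1 then f (n.+1 - m) else 0)) ->
  forall n, exists W : seq (seq bool),
    [/\ uniq W, forall z, z \in W -> tiling m n z & f n <= size W].
Proof.
move=> m_gt0 f0 fS; elim/ltn_ind => -[|n] IH.
  exists [:: [::]]; split=> // z; rewrite inE => /eqP ->.
  by split=> // i; rewrite nth_nil.
have [W1 [uW1 tW1 fW1]] := IH n (ltnSn n).
have t1 z : z \in [seq false :: w | w <- W1] -> tiling m n.+1 z.
  case/mapP => w /tW1 [zw hw] ->; split=> [|[|i] //= /hw [h1 h2]]; first by rewrite /= zw.
  by split=> //; rewrite addSn.
have u1 : uniq [seq false :: w | w <- W1] by rewrite map_inj_uniq // => ? ? [].
have := fS n; case: ifP => mn fn; last first.
  exists [seq false :: w | w <- W1]; split=> //; rewrite size_map.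
  by rewrite (leq_trans fn) // addn0.
have [|W2 [uW2 tW2 fW2]] := IH (n.+1 - m); first by lia.
pose tl := true :: nseq m.-1 false.
have ztl : size tl = m by rewrite /= size_nseq prednK.
exists ([seq false :: w | w <- W1] ++ [seq tl ++ w | w <- W2]); split.
- rewrite cat_uniq u1 /=; apply/andP; split; last first.
    by rewrite map_inj_uniq // => x y [] /eqP; rewrite eqseq_cat // eqxx => /eqP.
  by apply/hasPn => _ /mapP[w _ ->]; apply/mapP => -[].
- move=> z; rewrite mem_cat => /orP[/t1 //|/mapP[w /tW2 [zw hw] ->]].
  split; first by rewrite size_cat ztl zw; lia.
  have ntl i : nth false tl i = (i == 0) by case: i => //= i; rewrite nth_nseq if_same.
  move=> i; rewrite nth_cat ztl ntl; case: ltnP => im.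
    move/eqP => ->; split; first by [].
    by move=> o /andP[o0 om]; rewrite add0n nth_cat ztl om ntl; case: o o0 {om}.
  move=> /hw [h1 h2]; split; first lia.
  move=> o om; rewrite nth_cat ztl ltnNge (leq_trans im (leq_addr _ _)) /=.
  by rewrite -addnBAC // h2.
- by rewrite size_cat !size_map (leq_trans fn) ?leq_add.
Qed.

Lemma G_rec n : 1 < n -> G n.+2 = G n.+1 + G n.-1.
Proof. by case: n => [|[|n]]. Qed.

Lemma G_gt0 n : 0 < n -> 0 < G n.
Proof.
elim/ltn_ind: n => -[|[|[|[|n]]]] // IH _.
by rewrite (G_rec (n:=n.+2)) // addn_gt0 IH.
Qed.

Lemma G_leS n : G n <= G n.+1.
Proof. by case: n => [|[|[|n]]] //; rewrite (G_rec (n:=n.+2)) ?leq_addr. Qed.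

Lemma tilings1 L : exists W : seq (seq bool),
  [/\ uniq W, forall z, z \in W -> tiling 1 L z & G L.+2 <= size W].
Proof.
apply: (@tilings 1 (fun L => G L.+2)) => // -[|n] //.
rewrite (G_rec (n:=n.+2)) // (_ : n.+2 - 1 = n.+1) ?subSS //.
by rewrite leq_add2l (leq_trans (G_leS _)) ?G_leS.
Qed.

Lemma tilings2 L : exists W : seq (seq bool),
  [/\ uniq W, forall z, z \in W -> tiling 2 L z & G L.+1 <= size W].
Proof.
apply: (@tilings 2 (fun L => G L.+1)) => // -[|[|n]] //.
by rewrite (G_rec (n:=n.+2)) // (_ : n.+3 - 2 = n.+1) ?leq_add2l ?G_leS.
Qed.

Lemma tilings3 L : 0 < L -> exists W : seq (seq bool),
  [/\ uniq W, forall z, z \in W -> tiling 3 L z & G L <= size W].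
Proof.
move=> L0.
have [||//|W [uW tW fW]] := @tilings 3 (fun n => maxn 1 (G n)) _ _ _ L => //.
  case=> [|[|[|n]]] //.
  rewrite (G_rec (n:=n.+2)) // (_ : n.+4 - 3 = n.+1) //.
  by rewrite (maxn_idPr (G_gt0 (n:=n.+3) _)) // (maxn_idPr (G_gt0 (n:=n.+1) _)) //
    geq_max addn_gt0 G_gt0 //=.
by exists W; split=> //; rewrite (leq_trans _ fW) // leq_maxr.
Qed.

(* [off m z i] is the offset of position i in the tile of length m covering it
   (0 for an uncovered position). *)
Definition off (m : nat) (z : seq bool) (i : nat) : nat :=
  let o := find (fun o => (o <= i) && nth false z (i - o)) (iota 0 m) in
  if o < m then o else 0.

Definition start (m : nat) (z : seq bool) (i : nat) : nat := i - off m z i.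

Section Tiling.
Variables (m n : nat) (z : seq bool).
Hypotheses (m_gt0 : 0 < m) (tz : tiling m n z).

Lemma offP i :
  [/\ off m z i < m, off m z i <= i & nth false z (start m z i)] \/
  (off m z i = 0 /\ forall o, o < m -> o <= i -> nth false z (i - o) = false).
Proof.
rewrite /start /off; set p := fun o => _; case: (ltnP (find p (iota 0 m)) m) => h.
  left; have hp : has p (iota 0 m) by rewrite has_find size_iota.
  have := nth_find 0 hp; rewrite nth_iota // add0n {1}/p => /andP[h1 h2].
  by split.
right; split=> // o om oi; apply/negP => zo.
have : has p (iota 0 m) by apply/hasP; exists o; rewrite ?mem_iota // /p oi.
by rewrite has_find size_iota ltnNge h.
Qed.

Lemma off_ltn i : off m z i < m.
Proof. by case: (offP i) => [[]//|[-> _]]. Qed.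

Lemma start_off i : start m z i + off m z i = i.
Proof. by rewrite subnK //; case: (offP i) => [[]//|[-> _]]. Qed.

Lemma start_leq i : start m z i <= i.
Proof. exact: leq_subr. Qed.

Lemma tile_disjoint a b : nth false z a -> nth false z b -> a < b -> a + m <= b.
Proof.
move=> /tz.2 [_ h] zb ab; rewrite leqNgt; apply/negP => bm.
have := h (b - a); rewrite subnKC ?(ltnW ab) // zb => /(_ _)/implyP; lia.
Qed.

Lemma start_tile a o : nth false z a -> o < m ->
  start m z (a + o) = a /\ off m z (a + o) = o.
Proof.
move=> za om; have e := start_off (a + o).
case: (offP (a + o)) => [[h1 h2 h3]|[_ h]]; last first.
  by have := h o om; rewrite leq_addl addnK za => /(_ isT).
suff : start m z (a + o) = a by lia.
case: (ltngtP (start m z (a + o)) a) => // h.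
  by have := tile_disjoint h3 za h; lia.
by have := tile_disjoint za h3 h; lia.
Qed.

Lemma start_mono i j : i < j -> start m z i < start m z j \/
  start m z i = start m z j /\ off m z i < off m z j.
Proof.
move=> ij; have ei := start_off i; have ej := start_off j.
case: (offP i) => [[h1 h2 h3]|[hi h]]; case: (offP j) => [[k1 k2 k3]|[hj k]]; try lia.
- case: (ltngtP (start m z i) (start m z j)) => hs; try lia.
  by have := tile_disjoint k3 h3 hs; lia.
- left; rewrite ltnNge; apply/negP => hs.
  have := h (i - start m z j); rewrite subKn ?k3; last by lia.
  by move=> /(_ _ _)/implyP; lia.
Qed.

Lemma start_nontile a : nth false z a = false -> 1 < m ->
  start m z a < start m z (a + m.-1).
Proof.
move=> za m1; have [|//|[h1 h2]] := @start_mono a (a + m.-1); first lia.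
have ea := start_off a; have eb := start_off (a + m.-1).
have := off_ltn (a + m.-1); move=> h3.
case: (offP (a + m.-1)) => [[_ _ h]|[h _]]; last lia.
by move: h; have -> : start m z (a + m.-1) = a by [lia]; rewrite za.
Qed.

End Tiling.

(* Label i sits in the block [start i]; a tile is realized by the slots of a
   single block, in an order that depends on the phase [start %% m], so that the
   cluster of the slot used at label i only depends on [i %% m]. *)
Definition place (T S : Type) (V : nat -> S -> T) (m : nat)
    (sg : nat -> nat -> S) (z : seq bool) (i : nat) : T :=
  V (start m z i) (sg (start m z i %% m) (off m z i)).

Lemma place_order (S : Type) (V : nat -> S -> nat) (m n : nat)
    (sg : nat -> nat -> S) (Phi : nat -> nat -> bool) (z : seq bool) :
  0 < m -> tiling m n z ->
  (forall b b' f o f' o', b < b' -> b' < n -> f < m -> o < m -> f' < m -> o' < m ->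
     (V b (sg f o) < V b' (sg f' o')) = Phi ((f + o) %% m) ((f' + o') %% m) /\
     (V b' (sg f' o') < V b (sg f o)) = ~~ Phi ((f + o) %% m) ((f' + o') %% m)) ->
  (forall b f o o', b < n -> f < m -> o < o' -> o' < m ->
     (V b (sg f o) < V b (sg f o')) = Phi ((f + o) %% m) ((f + o') %% m) /\
     (V b (sg f o') < V b (sg f o)) = ~~ Phi ((f + o) %% m) ((f + o') %% m)) ->
  forall i j, i < j -> j < n ->
    (place V m sg z i < place V m sg z j) = Phi (i %% m) (j %% m) /\
    (place V m sg z j < place V m sg z i) = ~~ Phi (i %% m) (j %% m).
Proof.
move=> m0 tz h1 h2 i j ij jn; rewrite /place.
have mE k : ((start m z k %% m) + off m z k) %% m = k %% m.
  by rewrite modnDml start_off.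
rewrite -(mE i) -(mE j).
have lj := leq_ltn_trans (start_leq m z j) jn.
case: (start_mono m0 tz ij) => [h|[h h']].
  by apply: h1; rewrite ?ltn_mod ?off_ltn.
by rewrite h in h' *; apply: h2; rewrite ?ltn_mod ?off_ltn.
Qed.

Section FiniteCheck.

Fixpoint bitvecs (n : nat) : seq (seq bool) :=
  if n is n'.+1 then
    let s := bitvecs n' in map (cons true) s ++ map (cons false) s
  else [:: [::]].

Lemma mem_bitvecs n v : size v = n -> v \in bitvecs n.
Proof.
elim: n v => [|n IH] [|b v] //= [zv].
by rewrite mem_cat; case: b; rewrite map_f ?IH ?orbT.
Qed.

(* A vector of 12 bits describes the order on the vertices (block, slot) with
   three slots: bit 3s+t says whether (i,s) < (j,t) for i < j, and the last three
   bits compare two slots of the same block. *)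
Definition ordO (v : seq bool) (s t : nat) := nth false v (s * 3 + t).
Definition ordE (v : seq bool) (s t : nat) :=
  if s < t then nth false v (9 + (s + t).-1)
  else if t < s then ~~ nth false v (9 + (s + t).-1) else false.
Definition ordR (v : seq bool) (x y : nat * nat) :=
  if x.1 < y.1 then ordO v x.2 y.2
  else if y.1 < x.1 then ~~ ordO v y.2 x.2 else ordE v x.2 y.2.

(* Unlike [all], this stops at the first failure under call-by-value. *)
Fixpoint alls (A : Type) (p : A -> bool) (s : seq A) : bool :=
  if s is x :: s' then if p x then alls p s' else false else true.

Lemma allsE (A : Type) (p : A -> bool) s : alls p s = all p s.
Proof. by elim: s => //= x s ->; case: (p x). Qed.

Definition cells := [seq (i, s) | i <- iota 0 3, s <- iota 0 3].
Definition order_ok (v : seq bool) :=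
  alls (fun x => alls (fun y => if ordR v x y then
    alls (fun w => if ordR v y w then ordR v x w else true) cells else true) cells) cells.

Definition arr (c : seq (seq nat)) (f o : nat) := nth 0 (nth [::] c f) o.
Definition ordPhi (v : seq bool) (c : seq (seq nat)) (f f' : nat) :=
  ordO v (arr c f 0) (arr c f' 0).
Definition arr_ok (v : seq bool) (c : seq (seq nat)) :=
  alls (fun f => alls (fun o => alls (fun f' => alls (fun o' =>
    if ordO v (arr c f o) (arr c f' o') == ordPhi v c ((f + o) %% 3) ((f' + o') %% 3)
    then if o < o' then ordE v (arr c f o) (arr c f o') ==
           ordPhi v c ((f + o) %% 3) ((f + o') %% 3) else true
    else false)
    (iota 0 3)) (iota 0 3)) (iota 0 3)) (iota 0 3).
Definition perms3 : seq (seq nat) := [:: [:: 0; 1; 2]; [:: 0; 2; 1]; [:: 1; 0; 2];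
  [:: 1; 2; 0]; [:: 2; 0; 1]; [:: 2; 1; 0]].

Definition arrs : seq (seq (seq nat)) :=
  [seq [:: ab.1; ab.2; c] | ab <- [seq (a, b) | a <- perms3, b <- perms3], c <- perms3].

Lemma arr_exists v : size v = 12 -> order_ok v ->
  exists c, c \in arrs /\ arr_ok v c.
Proof.
move=> /mem_bitvecs vin ok.
have h : all (fun v => if order_ok v then ~~ alls (fun c => ~~ arr_ok v c) arrs else true) (bitvecs 12).
  by vm_compute.
have := allP h v vin; rewrite ok allsE => /allPn[c cin].
by move/negPn => cok; exists c; exact: conj cin cok.
Qed.

End FiniteCheck.

(** * Colors of triples and restrictions *)

Definition tri (N a b c : nat) : {set 'I_N} :=
  finset (fun i : 'I_N => val i \in [:: a; b; c]).

(* The color of {a, b, c}; [false] if these are not three distinct vertices. *)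
Definition col3 (N : nat) (chi : coloring_on N) (a b c : nat) : bool :=
  if insub (tri N a b c) is Some E then chi E == ord_max else false.

Section Col3.
Variables (N : nat) (chi : coloring_on N).

Lemma col3C a b c : col3 chi a b c = col3 chi b a c.
Proof.
rewrite /col3; suff -> : tri N a b c = tri N b a c by [].
by apply/setP => i; rewrite !inE orbCA.
Qed.

Lemma col3CA a b c : col3 chi a b c = col3 chi a c b.
Proof.
rewrite /col3; suff -> : tri N a b c = tri N a c b by [].
by apply/setP => i; rewrite !inE [(_ == b) || _]orbC.
Qed.

Lemma tri_card (a b c : 'I_N) : uniq [:: a; b; c] -> #|tri N a b c| == 3.
Proof.
move=> u; rewrite -(eqP (_ : size [:: a; b; c] == 3)) // -(card_uniqP u).
by rewrite (eq_card (B := mem [:: a; b; c])) // => i; rewrite !inE.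
Qed.

Lemma triE (E : triple N) : exists a b c : 'I_N,
  [/\ a < b, b < c & val E = tri N a b c].
Proof.
case: E => E /= E3.
have srt : sorted ltn (map val (enum E)).
  apply: (subseq_sorted ltn_trans _ (iota_ltn_sorted 0 N)).
  by rewrite -val_enum_ord; apply: map_subseq; rewrite enumT; exact: filter_subseq.
have mE i : (i \in enum E) = (i \in E) by rewrite mem_enum.
move: srt mE (eqP E3); rewrite cardE; case: (enum E) => [|a [|b [|c []]]] //=.
rewrite andbT => /andP[ab bc] mE _; exists a, b, c; split=> //.
by apply/setP => i; rewrite -mE !inE.
Qed.

Lemma bit2 (x y : 'I_2) : (x == ord_max) = (y == ord_max) -> x = y.
Proof. by case: x y => [[|[|]] // ?] [[|[|]] // ?] h; apply: val_inj. Qed.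

End Col3.

Lemma col3_ext (N : nat) (chi chi' : coloring_on N) :
  (forall a b c, a < b -> b < c -> c < N -> col3 chi a b c = col3 chi' a b c) ->
  chi = chi'.
Proof.
move=> h; apply/ffunP => E; have [a [b [c [ab bc eE]]]] := triE E.
have := h a b c ab bc (ltn_ord c); rewrite /col3 -eE valK; exact: bit2.
Qed.

Section Restriction.
Variables (X : set coloring) (hX : ideal X) (N : nat) (chi : coloring_on N).
Hypothesis (Xchi : X (Tagged coloring_on chi)).

Lemma restriction (n : nat) (y : nat -> nat) : 0 < n ->
  (forall i, i < n -> y i < N) -> (forall i j, i < j -> j < n -> y i < y j) ->
  exists phi : coloring_on n, phi \in slice X n /\
    forall a b c, a < n -> b < n -> c < n -> uniq [:: a; b; c] ->
      col3 phi a b c = col3 chi (y a) (y b) (y c).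
Proof.
move=> n0 yN yS; pose F (i : 'I_n) := Ordinal (yN i (ltn_ord i)).
have Finj : injective F.
  move=> i j /(congr1 val) /= e; apply: val_inj => /=.
  by case: (ltngtP i j) => // ij; have := yS _ _ ij (ltn_ord _); rewrite e ltnn.
exists [ffun E => chi (im_triple Finj E)]; split.
  rewrite inE; apply/asboolP; apply: (hX.2 _ (Tagged coloring_on chi)) => //.
  exists F, Finj; split; first by move=> i j ij; exact: yS.
  by move=> E /=; rewrite ffunE.
move=> a b c an bn cn u.
have u' : uniq [:: Ordinal an; Ordinal bn; Ordinal cn].
  by rewrite -(map_inj_uniq val_inj).
pose E0 : triple n := exist (fun E : {set 'I_n} => #|E| == 3) (tri n a b c) (tri_card u').
have e1 : tri n a b c = val E0 by [].
rewrite {1}/col3 e1 valK ffunE /col3.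
suff -> : tri N (y a) (y b) (y c) = val (im_triple Finj E0) by rewrite valK.
apply/setP => i; rewrite !inE /=; apply/idP/imsetP => [|[j + ->]].
  case/or3P => /eqP e.
  - by exists (Ordinal an); [rewrite !inE eqxx|apply: val_inj].
  - by exists (Ordinal bn); [rewrite !inE eqxx !orbT|apply: val_inj].
  - by exists (Ordinal cn); [rewrite !inE eqxx !orbT|apply: val_inj].
by rewrite !inE => /or3P[] /eqP e; rewrite /= e eqxx ?orbT.
Qed.

Lemma count_labelings (n : nat) (T : eqType) (W : seq T) (y : T -> nat -> nat)
    (Ord : nat -> nat -> bool) : 0 < n -> uniq W ->
  (forall w i, w \in W -> i < n -> y w i < N) ->
  (forall w i j, w \in W -> i < j -> j < n ->
     (y w i < y w j) = Ord i j /\ (y w j < y w i) = ~~ Ord i j) ->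
  (forall w w', w \in W -> w' \in W -> w != w' -> exists a b c,
     [/\ a < n, b < n, c < n, uniq [:: a; b; c] &
      col3 chi (y w a) (y w b) (y w c) != col3 chi (y w' a) (y w' b) (y w' c)]) ->
  size W <= #|slice X n|.
Proof.
move=> n0 uW yN yO ysep.
case: (W =P [::]) => [-> //|/eqP]; rewrite -size_eq0 -lt0n -has_predT.
case/hasP => w0 w0W _.
pose s := sort (fun i j => y w0 i <= y w0 j) (iota 0 n).
have ps : perm_eq s (iota 0 n) by rewrite perm_sort.
have zs : size s = n by rewrite (perm_size ps) size_iota.
have us : uniq s by rewrite (perm_uniq ps) iota_uniq.
have ms i : (i \in s) = (i < n) by rewrite (perm_mem ps) mem_iota.
pose p k := nth 0 s k.
have pn k : k < n -> p k < n by move=> kn; rewrite -ms mem_nth ?zs.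
have pinj k l : k < n -> l < n -> (p k == p l) = (k == l).
  by move=> kn ln; rewrite nth_uniq ?zs.
have pS w k l : w \in W -> k < l -> l < n -> y w (p k) < y w (p l).
  move=> wW kl ln; have kn := ltn_trans kl ln.
  have : y w0 (p k) <= y w0 (p l).
    have srt : sorted (fun i j => y w0 i <= y w0 j) s.
      by apply: sort_sorted => i j; exact: leq_total.
    have tr : transitive (fun i j => y w0 i <= y w0 j) by move=> ? ? ?; exact: leq_trans.
    by apply: (sorted_ltn_nth tr) => //; rewrite inE zs.
  have := pinj k l kn ln; rewrite (ltn_eqF kl).
  case: (ltngtP (p k) (p l)) => // pkl _.
    have [_ h0] := yO w0 _ _ w0W pkl (pn _ ln).
    have [-> _] := yO w _ _ wW pkl (pn _ ln).
    by rewrite leqNgt h0 negbK.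
  have [h0 _] := yO w0 _ _ w0W pkl (pn _ kn).
  have [_ ->] := yO w _ _ wW pkl (pn _ kn).
  by rewrite leqNgt h0.
have /choice[F hF] : forall w, exists phi : coloring_on n, w \in W -> phi \in slice X n /\
    forall a b c, a < n -> b < n -> c < n -> uniq [:: a; b; c] ->
      col3 phi a b c = col3 chi (y w (p a)) (y w (p b)) (y w (p c)).
  move=> w; case: (boolP (w \in W)) => [wW|_]; last by exists [ffun=> ord0].
  have [||phi hphi] := @restriction n (fun k => y w (p k)) n0.
  - by move=> i /pn; exact: (yN _ _ wW).
  - by move=> i j; exact: (pS _ _ _ wW).
  - by exists phi.
have Finj : {in W &, injective F}.
  move=> w w' wW wW' eF; apply/eqP/negPn/negP => /(ysep _ _ wW wW').
  case=> a [b [c [an bn cn u /negP]]]; apply; apply/eqP.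
  have ip x : x < n -> index x s < n by rewrite -ms -index_mem zs.
  have pi x : x < n -> p (index x s) = x by move=> xn; rewrite /p nth_index // ms.
  have u' : uniq [:: index a s; index b s; index c s].
    move: u; rewrite -{1}(pi a an) -{1}(pi b bn) -{1}(pi c cn) /= !inE.
    by rewrite !pinj ?ip.
  have := (hF w wW).2 _ _ _ (ip a an) (ip b bn) (ip c cn) u'.
  rewrite eF ((hF w' wW').2 _ _ _ (ip a an) (ip b bn) (ip c cn) u').
  by rewrite !pi.
rewrite -(size_map F) cardE; apply: uniq_leq_size.
  by rewrite map_inj_in_uniq.
by move=> _ /mapP[w wW ->]; rewrite mem_enum; exact: (hF w wW).1.
Qed.

End Restriction.

(** * Blocks *)

Definition lto (d : bool) (a b : nat) := if d then a < b else b < a.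

(* Block j consists of two vertices V j 0, V j 1 that are told apart by the
   pair V j 2, V j 3; the pairs (V j 0, V j 1) are monotone in j. *)
Definition blocks (N : nat) (chi : coloring_on N) (d : bool)
    (V : nat -> nat -> nat) (M : nat) : Prop :=
  [/\ forall j, j < M -> uniq [:: V j 0; V j 1; V j 2; V j 3],
      forall j s, j < M -> s < 4 -> V j s < N,
      forall j, j < M ->
        col3 chi (V j 0) (V j 2) (V j 3) != col3 chi (V j 1) (V j 2) (V j 3)
    & forall j k s t, j < k -> k < M -> s < 2 -> t < 2 -> lto d (V j s) (V k t)].

Definition const_slot (V : nat -> nat -> nat) (M s : nat) :=
  forall j, j < M -> V j s = V 0 s.

Section Blocks.
Variables (N : nat) (chi : coloring_on N).

Lemma blocks_reindex d V M' M (g : nat -> nat) : blocks chi d V M' ->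
  (forall i, i < M -> g i < M') -> (forall i j, i < j -> j < M -> g i < g j) ->
  blocks chi d (fun j => V (g j)) M.
Proof.
case=> h1 h2 h3 h4 gM gS; split.
- by move=> j /gM; exact: h1.
- by move=> j s /gM; exact: h2.
- by move=> j /gM; exact: h3.
- by move=> j k s t jk kM; apply: h4; [exact: gS|exact: gM].
Qed.

Lemma blocks_leq d V M' M : M <= M' -> blocks chi d V M' -> blocks chi d V M.
Proof.
by move=> h /(@blocks_reindex _ _ _ M id); apply=> // i iM; exact: leq_trans h.
Qed.

Lemma blocks_swap d V M : blocks chi d V M ->
  blocks chi d (fun j s => V j (nth 0 [:: 0; 1; 3; 2] s)) M.
Proof.
case=> h1 h2 h3 h4; split.
- by move=> j /h1 /=; rewrite !inE !negb_or !andbT; lia.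
- by move=> j s jM s4; apply: h2 => //; case: s s4 => [|[|[|[|]]]].
- by move=> j jM /=; rewrite col3CA [X in _ != X]col3CA h3.
- by move=> j k [|[|s]] [|[|t]] //= jk kM _ _; exact: h4.
Qed.

Section Canon.
Variables (V : nat -> nat -> nat) (M : nat).
Hypotheses (cV : canonical_on V (col3 chi) M) (M3 : 2 < M).

Lemma canon_lt a b a' b' s t : a < M -> b < M -> a' < M -> b' < M -> s < 4 -> t < 4 ->
  same_order a b a' b' -> (V a s < V b t) = (V a' s < V b' t).
Proof. by case: cV => h _; exact: h. Qed.

Lemma canon_eq a b a' b' s t : a < M -> b < M -> a' < M -> b' < M -> s < 4 -> t < 4 ->
  same_order a b a' b' -> (V a s == V b t) = (V a' s == V b' t).
Proof.
move=> aM bM a'M b'M s4 t4 [h1 h2].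
have e1 : (V a s < V b t) = (V a' s < V b' t) by apply: canon_lt.
have e2 : (V b t < V a s) = (V b' t < V a' s) by apply: canon_lt.
by lia.
Qed.

Lemma canon_const s : s < 4 -> V 0 s = V 1 s -> const_slot V M s.
Proof.
move=> s4 /eqP e [|j] jM //; apply/eqP; rewrite eq_sym.
by rewrite (canon_eq (a' := 0) (b' := 1)) // ?/same_order; lia.
Qed.

Lemma canon_neq a b s t : a < M -> b < M -> s < 4 -> t < 4 ->
  V 0 s != V 1 s -> V 0 t != V 1 t -> a != b -> V a s != V b t.
Proof.
move=> aM bM s4 t4 ns nt ab; apply/negP => e; case: (ltngtP a b) ab => // ab _.
- have e1 : V 0 s == V 1 t by rewrite (canon_eq (a' := a) (b' := b)) // ?/same_order; lia.
  have e2 : V 0 s == V 2 t by rewrite (canon_eq (a' := a) (b' := b)) // ?/same_order; lia.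
  have e3 : V 1 t == V 2 t by rewrite -(eqP e1).
  by move/negP: nt; apply; rewrite (canon_eq (a' := 1) (b' := 2)) // ?/same_order; lia.
- have e1 : V 1 s == V 0 t by rewrite (canon_eq (a' := a) (b' := b)) // ?/same_order; lia.
  have e2 : V 2 s == V 0 t by rewrite (canon_eq (a' := a) (b' := b)) // ?/same_order; lia.
  have e3 : V 1 s == V 2 s by rewrite (eqP e1) eq_sym.
  by move/negP: ns; apply; rewrite (canon_eq (a' := 1) (b' := 2)) // ?/same_order; lia.
Qed.

Lemma canon_col a b c a' b' c' s t r : a < M -> b < M -> c < M ->
  a' < M -> b' < M -> c' < M -> s < 4 -> t < 4 -> r < 4 ->
  same_order a b a' b' -> same_order b c b' c' -> same_order a c a' c' ->
  col3 chi (V a s) (V b t) (V c r) = col3 chi (V a' s) (V b' t) (V c' r).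
Proof. by case: cV => _; apply. Qed.

(* Two slots t, t' are in one cluster when the vertices in these slots are
   monotone in the block number, whichever slot is taken in each block. *)
Definition cluster (d : bool) (t t' : nat) :=
  [&& lto d (V 0 t) (V 1 t), lto d (V 0 t) (V 1 t'),
      lto d (V 0 t') (V 1 t) & lto d (V 0 t') (V 1 t')].

Lemma canon_lto d a b s t : a < b -> b < M -> s < 4 -> t < 4 ->
  lto d (V a s) (V b t) = lto d (V 0 s) (V 1 t).
Proof.
move=> ab bM s4 t4; rewrite /lto; case: d; apply: canon_lt; rewrite /same_order; lia.
Qed.

Lemma cluster_side d r s t a b : const_slot V M r -> r < 4 -> s < 4 -> t < 4 ->
  cluster d s t -> a < M -> b < M ->
  (V a s < V b r) = (V 0 t < V 0 r).
Proof.
move=> cr r4 s4 t4 /and4P[h1 h2 h3 h4] aM bM.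
rewrite (cr b) // -(cr a) //.
have -> : (V a s < V a r) = (V 0 s < V 0 r).
  by apply: canon_lt; rewrite // /same_order; lia.
have e1 : (V 1 s < V 1 r) = (V 0 s < V 0 r).
  by apply: canon_lt; rewrite // /same_order; lia.
have e2 : (V 1 t < V 1 r) = (V 0 t < V 0 r).
  by apply: canon_lt; rewrite // /same_order; lia.
have e3 : V 1 r = V 0 r by apply: cr; lia.
have e4 : V a r = V 0 r by apply: cr.
rewrite e3 in e1 e2.
move: h1 h2 h3 h4; rewrite /lto; case: d; lia.
Qed.

(* A difference of colors at b, b', e, c is repeated at every block of V by
   canonicity, which yields new blocks. *)
Lemma reblock M' d b b' e c t t' s r (be be' ep ga : nat -> nat) :
  (forall j s, j < M -> s < 4 -> V j s < N) ->
  b < M -> b' < M -> e < M -> c < M -> t < 4 -> t' < 4 -> s < 4 -> r < 4 ->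
  col3 chi (V b t) (V e s) (V c r) != col3 chi (V b' t') (V e s) (V c r) ->
  cluster d t t' ->
  (forall j, j < M' -> [/\ be j < M, be' j < M, ep j < M & ga j < M]) ->
  (forall j k, j < k -> k < M' ->
     [/\ be j < be k, be j < be' k, be' j < be k & be' j < be' k]) ->
  (forall j, j < M' -> [/\ same_order b e (be j) (ep j), same_order b c (be j) (ga j),
     same_order e c (ep j) (ga j), same_order b' e (be' j) (ep j)
     & same_order b' c (be' j) (ga j)]) ->
  (forall j, j < M' -> [/\ V (be j) t != V (ep j) s, V (be j) t != V (ga j) r,
     V (be' j) t' != V (ep j) s, V (be' j) t' != V (ga j) r & V (ep j) s != V (ga j) r]) ->
  blocks chi d (fun j => nth 0 [:: V (be j) t; V (be' j) t'; V (ep j) s; V (ga j) r]) M'.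
Proof.
move=> VN bM b'M eM cM t4 t'4 s4 r4 hcol /and4P[c1 c2 c3 c4] hM hmono hord hneq.
have dif j : j < M' ->
    col3 chi (V (be j) t) (V (ep j) s) (V (ga j) r) !=
    col3 chi (V (be' j) t') (V (ep j) s) (V (ga j) r).
  move=> jM; have [h1 h2 h3 h4] := hM j jM; have [o1 o2 o3 o4 o5] := hord j jM.
  have <- // := @canon_col b e c (be j) (ep j) (ga j) t s r.
  by have <- // := @canon_col b' e c (be' j) (ep j) (ga j) t' s r.
split.
- move=> j jM; have [h1 h2 h3 h4 h5] := hneq j jM.
  rewrite /= !inE !negb_or h1 h2 h3 h4 h5 !andbT.
  by apply: contraNneq (dif j jM) => ->.
- move=> j s' jM; have [h1 h2 h3 h4] := hM j jM.
  by case: s' => [|[|[|[|]]]] //= _; apply: VN.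
- exact: dif.
- move=> j k s' t'' jk kM; have [h1 h2 h3 h4] := hmono j k jk kM.
  have [h1' h2' h3' h4'] := hM k kM.
  by case: s' => [|[|]] //; case: t'' => [|[|]] //= _ _; rewrite canon_lto.
Qed.

End Canon.
End Blocks.

Section CommonPair.
Variables (X : set coloring) (hX : ideal X) (n : nat).
Hypotheses (n23 : 22 < n) (small : #|slice X n| < G n).

Lemma no_blocks_reduce (P : (nat -> nat -> nat) -> nat -> Prop) :
  (forall V M M' g, P V M' -> (forall i, i < M -> g i < M') -> P (fun j => V (g j)) M) ->
  (exists M, 2 < M /\ forall N (chi : coloring_on N) d V, X (Tagged coloring_on chi) ->
     blocks chi d V M -> canonical_on V (col3 chi) M -> P V M -> False) ->
  exists M, forall N (chi : coloring_on N) d V, X (Tagged coloring_on chi) ->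
     blocks chi d V M -> P V M -> False.
Proof.
move=> hP [M [M3 hM]]; have [M' hM'] := canonical_blocks M.
exists M' => N chi d V Xc bV PV; have [g [gM gS cV]] := hM' V (col3 chi).
by apply: hM Xc (blocks_reindex bV gM gS) cV (hP _ _ _ _ PV gM).
Qed.

Lemma const_reindex r V M M' g : const_slot V M' r -> (forall i, i < M -> g i < M') ->
  const_slot (fun j => V (g j)) M r.
Proof.
move=> h gM j jM; rewrite h ?gM //.
by rewrite -(h (g 0)) // gM // (leq_ltn_trans _ jM).
Qed.

Lemma no_blocks_common_pair : exists M, forall N (chi : coloring_on N) d V, X (Tagged coloring_on chi) ->
  blocks chi d V M -> const_slot V M 2 /\ const_slot V M 3 -> False.
Proof.
apply: (@no_blocks_reduce (fun V M => const_slot V M 2 /\ const_slot V M 3)).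
  by move=> V M M' g [h1 h2] gM; split; apply: const_reindex gM.
exists n; split; first lia.
move=> N chi d V Xc [h1 h2 h3 h4] cV [k2 k3].
have n3 : 2 < n by lia.
have cl s t : s < 2 -> t < 2 -> cluster V d s t.
  by move=> s2 t2; apply/and4P; split; apply: h4; lia.
have [W [uW tW gW]] := tilings1 (n - 2).
move: gW; rewrite (_ : (n - 2).+2 = n); last lia.
apply/negP; rewrite -ltnNge; apply: leq_ltn_trans small.
pose y (z : seq bool) i := if i < n - 2 then V i (nth false z i) else V 0 (i - (n - 2) + 2).
have side r z i : i < n - 2 -> r < 2 ->
    (V i (nth false z i) < V 0 (r + 2)) = (V 0 0 < V 0 (r + 2)) /\
    (V 0 (r + 2) < V i (nth false z i)) = ~~ (V 0 0 < V 0 (r + 2)).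
  move=> iL r2; have rc : const_slot V n (r + 2) by case: r r2 => [|[|]].
  have s2 : nth false z i < 2 by case: nth.
  have e := @cluster_side _ _ _ _ cV n3 d (r + 2) (nth false z i) 0 i 0 rc.
  rewrite -e ?cl //; try lia; split=> //.
  suff ne : V 0 (r + 2) != V i (nth false z i) by lia.
  rewrite -(rc i); last lia.
  have iN : i < n by lia.
  have := h1 i iN; rewrite /= !inE; case: r r2 {rc e} => [|[|]] // _; rewrite ?add0n ?add1n; case: nth => /=; lia.
pose Ord i j := if j < n - 2 then d else if i < n - 2 then V 0 0 < V 0 (j - (n - 2) + 2)
   else V 0 2 < V 0 3.
apply: (@count_labelings X hX N chi Xc n _ W y Ord) => //; first lia.
- move=> z i _ i_n; rewrite /y; case: (ltnP i (n - 2)) => hi; apply: h2; lia.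
- move=> z i j _ ij jn; rewrite /y /Ord; case: (ltnP j (n - 2)) => hj.
    rewrite (ltn_trans ij hj).
    have : lto d (V i (nth false z i)) (V j (nth false z j)).
      by apply: h4; rewrite ?(ltn_trans hj); try lia; case: nth.
    by rewrite /lto; case: (d) => h; split; lia.
  case: (ltnP i (n - 2)) => hi; first by apply: side; lia.
  have -> : i - (n - 2) = 0 by lia. have -> : j - (n - 2) = 1 by lia.
  by rewrite add0n add1n; have := h1 0 (ltn_trans _ n3); rewrite /= !inE => /(_ isT); split; lia.
- move=> z z' /tW [zz _] /tW [zz' _] zne.
  have [i iL ne] : exists2 i, i < n - 2 & nth false z i != nth false z' i.
    apply/not_exists2P => hz; move/eqP: zne; apply; apply: (@eq_from_nth _ false).
      by rewrite zz zz'.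
    rewrite zz => i iL; case: (hz i) => // /negP; rewrite negbK => /eqP //.
  exists i, (n - 2), (n - 1); split; try lia.
    by rewrite /= !inE; lia.
  rewrite /y iL ltnn (_ : n - 1 < n - 2 = false); last lia.
  rewrite (_ : n - 1 - (n - 2) = 1); last lia.
  rewrite subnn add0n add1n -(k2 i) -1?(k3 i); try lia.
  have := h3 i; case: (nth false z i) (nth false z' i) ne => [] [] //= _; first rewrite eq_sym; apply; lia.
Qed.

End CommonPair.

(** * Colorings from tilings *)

Lemma seq_bool_neq (L : nat) (z z' : seq bool) : size z = L -> size z' = L ->
  z != z' -> exists a, nth false z a != nth false z' a.
Proof.
move=> zz zz' zne; apply/not_existsP => hz; move/eqP: zne; apply.
apply: (@eq_from_nth _ false); first by rewrite zz zz'.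
by move=> i _; have /negP := hz i; rewrite negbK => /eqP.
Qed.

Section Counting.
Variables (X : set coloring) (hX : ideal X) (n : nat).
Hypotheses (n23 : 22 < n) (small : #|slice X n| < G n).
Variables (N : nat) (chi : coloring_on N).
Hypothesis Xc : X (Tagged coloring_on chi).
Variables (S : Type) (V : nat -> S -> nat) (sg : nat -> nat -> S) (Phi : nat -> nat -> bool).

Section Order.
Variable m L : nat.

Definition tile_order :=
  (forall b b' f o f' o', b < b' -> b' < L -> f < m -> o < m -> f' < m -> o' < m ->
     (V b (sg f o) < V b' (sg f' o')) = Phi ((f + o) %% m) ((f' + o') %% m) /\
     (V b' (sg f' o') < V b (sg f o)) = ~~ Phi ((f + o) %% m) ((f' + o') %% m)) /\
  (forall b f o o', b < L -> f < m -> o < o' -> o' < m ->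
     (V b (sg f o) < V b (sg f o')) = Phi ((f + o) %% m) ((f + o') %% m) /\
     (V b (sg f o') < V b (sg f o)) = ~~ Phi ((f + o) %% m) ((f + o') %% m)).
End Order.

Lemma tiles2_count (p : nat) (Psi : nat -> bool) : tile_order 2 (n - 1) ->
  (forall b f o, b < n - 1 -> f < 2 -> o < 2 ->
     [/\ V b (sg f o) < N, (V b (sg f o) < p) = Psi ((f + o) %% 2)
       & (p < V b (sg f o)) = ~~ Psi ((f + o) %% 2)]) ->
  p < N ->
  (forall a f k f0 o0 l f1 o1, a < n - 1 -> f < 2 -> k < l -> l < n - 1 ->
     f0 < 2 -> o0 < 2 -> f1 < 2 -> o1 < 2 ->
     (f0 + o0) %% 2 = f -> (f1 + o1) %% 2 = (f + 1) %% 2 ->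
     col3 chi (V a (sg f 0)) (V a (sg f 1)) p !=
     col3 chi (V k (sg f0 o0)) (V l (sg f1 o1)) p) ->
  False.
Proof.
move=> [O1 O2] side pN hcol.
have [W [uW tW gW]] := tilings2 (n - 1).
move: gW; rewrite (_ : (n - 1).+1 = n); last lia.
apply/negP; rewrite -ltnNge; apply: leq_ltn_trans small.
pose y z i := if i < n - 1 then place V 2 sg z i else p.
pose Ord i j := if j < n - 1 then Phi (i %% 2) (j %% 2) else Psi (i %% 2).
have sd z i : tiling 2 (n - 1) z -> i < n - 1 ->
    [/\ place V 2 sg z i < N, (place V 2 sg z i < p) = Psi (i %% 2)
       & (p < place V 2 sg z i) = ~~ Psi (i %% 2)].
  move=> tz iL; have := side (start 2 z i) (start 2 z i %% 2) (off 2 z i).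
  rewrite modnDml start_off; apply; rewrite ?ltn_mod ?off_ltn //.
  exact: leq_ltn_trans (start_leq _ _ _) iL.
apply: (@count_labelings X hX N chi Xc n _ W y Ord) => //; first lia.
- by move=> z i /tW tz _; rewrite /y; case: (ltnP i (n - 1)) => // /(sd z i tz)[].
- move=> z i j /tW tz ij jn; rewrite /y /Ord; have iL : i < n - 1 by lia.
  rewrite iL; case: (ltnP j (n - 1)) => hj; last by have [] := sd z i tz iL.
  exact: place_order tz O1 O2 _ _ ij hj.
move=> z z' /tW tz /tW tz' /(seq_bool_neq tz.1 tz'.1)[a].
suff sep w w' : tiling 2 (n - 1) w -> tiling 2 (n - 1) w' -> nth false w a ->
    nth false w' a = false -> exists a b c, [/\ a < n, b < n, c < n, uniq [:: a; b; c] &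
    col3 chi (y w a) (y w b) (y w c) != col3 chi (y w' a) (y w' b) (y w' c)].
  case ea : (nth false z a); case ea' : (nth false z' a) => // _; first exact: sep ea ea'.
  have [i [j [k [h1 h2 h3 h4 h5]]]] := sep _ _ tz' tz ea' ea.
  by exists i, j, k; split; rewrite // eq_sym.
move: w w' => {z z' tz tz'} z z' tz tz' za za'.
have [aL _] := tz.2 a za.
exists a, (a + 1), (n - 1); split; try lia; first by rewrite /= !inE; lia.
rewrite /y ltnn (_ : a < n - 1); last lia.
rewrite (_ : a + 1 < n - 1); last lia.
have [s0 o0] := start_tile (isT : 0 < 2) tz za (isT : 0 < 2).
have [s1 o1] := start_tile (isT : 0 < 2) tz za (isT : 1 < 2).
rewrite addn0 in s0 o0; rewrite /place s0 o0 s1 o1.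
apply: hcol; rewrite ?ltn_mod ?off_ltn //; try lia.
- exact: (@start_nontile 2 (n - 1) z' isT tz' a za' isT).
- by apply: leq_ltn_trans (start_leq _ _ _) _; lia.
- by rewrite modnDml start_off.
- by rewrite modnDml start_off modnDml.
Qed.

Lemma tiles3_count : tile_order 3 n ->
  (forall b f o, b < n -> f < 3 -> o < 3 -> V b (sg f o) < N) ->
  (forall a f k f0 o0 l f1 o1 q f2 o2, a < n -> f < 3 ->
     k < l \/ [/\ k = l, f0 = f1 & o0 < o1] -> l < q \/ [/\ l = q, f1 = f2 & o1 < o2] ->
     k < q -> q < n -> f0 < 3 -> o0 < 3 -> f1 < 3 -> o1 < 3 -> f2 < 3 -> o2 < 3 ->
     (f0 + o0) %% 3 = f -> (f1 + o1) %% 3 = (f + 1) %% 3 ->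
     (f2 + o2) %% 3 = (f + 2) %% 3 ->
     col3 chi (V a (sg f 0)) (V a (sg f 1)) (V a (sg f 2)) !=
     col3 chi (V k (sg f0 o0)) (V l (sg f1 o1)) (V q (sg f2 o2))) ->
  False.
Proof.
move=> [O1 O2] side hcol.
have n0 : 0 < n by lia.
have [W [uW tW gW]] := tilings3 n0.
move: gW; apply/negP; rewrite -ltnNge; apply: leq_ltn_trans small.
apply: (@count_labelings X hX N chi Xc n _ W (fun z => place V 3 sg z)
  (fun i j => Phi (i %% 3) (j %% 3))) => //.
- move=> z i _ ni; apply: side; rewrite ?ltn_mod ?off_ltn //.
  exact: leq_ltn_trans (start_leq _ _ _) ni.
- move=> z i j /tW tz ij jn; exact: place_order tz O1 O2 _ _ ij jn.
move=> z z' /tW tz /tW tz' /(seq_bool_neq tz.1 tz'.1)[a].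
suff sep w w' : tiling 3 (n) w -> tiling 3 (n) w' -> nth false w a ->
    nth false w' a = false -> exists a b c, [/\ a < n, b < n, c < n, uniq [:: a; b; c] &
    col3 chi (place V 3 sg w a) (place V 3 sg w b) (place V 3 sg w c) != col3 chi (place V 3 sg w' a) (place V 3 sg w' b) (place V 3 sg w' c)].
  case ea : (nth false z a); case ea' : (nth false z' a) => // _; first exact: sep ea ea'.
  have [i [j [k [h1 h2 h3 h4 h5]]]] := sep _ _ tz' tz ea' ea.
  by exists i, j, k; split; rewrite // eq_sym.
move: w w' => {z z' tz tz'} z z' tz tz' za za'.
have [aL _] := tz.2 a za.
exists a, (a + 1), (a + 2); split; try lia; first by rewrite /= !inE; lia.
have [s0 o0] := start_tile (isT : 0 < 3) tz za (isT : 0 < 3).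
have [s1 o1] := start_tile (isT : 0 < 3) tz za (isT : 1 < 3).
have [s2 o2] := start_tile (isT : 0 < 3) tz za (isT : 2 < 3).
have mono i j : i < j -> start 3 z' i < start 3 z' j \/
    [/\ start 3 z' i = start 3 z' j, start 3 z' i %% 3 = start 3 z' j %% 3
      & off 3 z' i < off 3 z' j].
  by case/(start_mono (isT : 0 < 3) tz') => [|[e1 e2]]; [left|right; rewrite e1].
rewrite addn0 in s0 o0; rewrite /place s0 o0 s1 o1 s2 o2.
apply: hcol; rewrite ?ltn_mod ?off_ltn //; try lia.
- by apply: mono; lia.
- by apply: mono; lia.
- exact: (@start_nontile 3 n z' isT tz' a za' isT).
- by apply: leq_ltn_trans (start_leq _ _ _) _; lia.
- by rewrite modnDml start_off.
- by rewrite modnDml start_off modnDml.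
- by rewrite modnDml start_off modnDml.
Qed.

End Counting.

Lemma same_order_lt a b a' b' : a < b -> a' < b' -> same_order a b a' b'.
Proof. by rewrite /same_order; lia. Qed.

Lemma same_order_gt a b a' b' : b < a -> b' < a' -> same_order a b a' b'.
Proof. by rewrite /same_order; lia. Qed.

Lemma same_order_eq a b : same_order a a b b.
Proof. by rewrite /same_order !ltnn. Qed.

Lemma neq_gtn x y : x != y -> (y < x) = ~~ (x < y).
Proof. lia. Qed.

Section MoreCanon.
Variables (N : nat) (chi : coloring_on N) (V : nat -> nat -> nat) (M : nat).
Hypotheses (cV : canonical_on V (col3 chi) M) (M3 : 2 < M).

Lemma canon_cluster s t : s < 4 -> t < 4 -> V 0 s != V 1 s -> V 0 t != V 1 t ->
  (V 0 s < V 1 t) = (V 0 t < V 1 s) -> cluster V (V 0 s < V 1 t) s t.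
Proof.
move=> s4 t4 ns nt e.
have e1 : (V 1 t < V 2 s) = (V 0 t < V 1 s) by apply: (canon_lt cV); rewrite /same_order; lia.
have e2 : (V 0 s < V 2 s) = (V 0 s < V 1 s) by apply: (canon_lt cV); rewrite /same_order; lia.
have e3 : (V 1 s < V 2 t) = (V 0 s < V 1 t) by apply: (canon_lt cV); rewrite /same_order; lia.
have e4 : (V 0 t < V 2 t) = (V 0 t < V 1 t) by apply: (canon_lt cV); rewrite /same_order; lia.
have n1 : V 0 s != V 1 t by apply: (canon_neq cV); lia.
have n2 : V 0 t != V 1 s by apply: (canon_neq cV); lia.
have n3 : V 1 s != V 2 t by apply: (canon_neq cV); lia.
have n4 : V 1 t != V 2 s by apply: (canon_neq cV); lia.
rewrite /cluster /lto -e; case h : (V 0 s < V 1 t) in e e1 e2 e3 e4 *; lia.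
Qed.

Lemma canon_separated s t : s < 4 -> t < 4 -> V 0 s != V 1 s -> V 0 t != V 1 t ->
  (V 0 s < V 1 t) <> (V 0 t < V 1 s) ->
  (V 0 s < V 0 t) = (V 0 s < V 1 t).
Proof.
move=> s4 t4 ns nt e.
have e1 : (V 1 s < V 1 t) = (V 0 s < V 0 t) by apply: (canon_lt cV); rewrite /same_order; lia.
have n1 : V 0 s != V 1 t by apply: (canon_neq cV); lia.
have n2 : V 0 t != V 1 s by apply: (canon_neq cV); lia.
case h : (V 0 s < V 1 t) in e e1 *; lia.
Qed.

Lemma canon_gt a b s t : a < M -> b < M -> s < 4 -> t < 4 ->
  V 0 s != V 1 s -> V 0 t != V 1 t -> a != b -> (V b t < V a s) = ~~ (V a s < V b t).
Proof. by move=> aM bM s4 t4 ns nt ab; have := canon_neq cV M3 aM bM s4 t4 ns nt ab; lia. Qed.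

End MoreCanon.

Lemma block_neq N (chi : coloring_on N) d V M j s t : blocks chi d V M -> j < M ->
  s < 4 -> t < 4 -> s != t -> V j s != V j t.
Proof.
case=> h _ _ _ /h; rewrite /= !inE.
by case: s => [|[|[|[|]]]] //; case: t => [|[|[|[|]]]] //; lia.
Qed.

Section CommonVertex.
Variables (X : set coloring) (hX : ideal X) (n : nat).
Hypotheses (n23 : 22 < n) (small : #|slice X n| < G n).

Lemma no_blocks_common_vertex : exists M, forall N (chi : coloring_on N) d V, X (Tagged coloring_on chi) ->
  blocks chi d V M -> const_slot V M 2 -> False.
Proof.
have [M1 hC1] := no_blocks_common_pair hX n23 small.
apply: (@no_blocks_reduce X (fun V M => const_slot V M 2)); first by move=> V M M' g h gM; exact: const_reindex h gM.
pose K := n + 4; pose M := (M1 + 2) * K + 2 * n + 3.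
have KM : K < M by rewrite /M mulnDl; lia.
have M1M : M1 <= M by rewrite /M /K; nia.
have MK : M1 * K + 2 * K <= M by rewrite /M mulnDl; lia.
have nM2 : 2 * n + 3 <= M by rewrite /M leq_add2r leq_addl.
have nK : n < K by rewrite /K; lia.
exists M; clearbody M K; have M3 : 2 < M by apply: leq_trans nM2; rewrite leq_addl.
have i0 : 0 < M by exact: leq_trans M3.
have i1 : 1 < M by exact: leq_trans M3.
have nM a : a < n -> a < M by move=> an; apply: ltn_trans KM; exact: ltn_trans nK.
split=> // N chi d V Xc bV cV k2; have [_ h2 h3 h4] := bV.
have nc0 s : s < 2 -> V 0 s != V 1 s.
  by move=> s2; have := h4 0 1 s s isT i1 s2 s2; rewrite /lto; case: (d); lia.
have nc3 : V 0 3 != V 1 3.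
  apply/negP => /eqP /(canon_const cV M3 (isT : 3 < 4)) k3.
  apply: (hC1 N chi d V Xc (blocks_leq M1M bV)); split.
    by move=> j jM; apply: k2; exact: leq_trans M1M.
  by move=> j jM; apply: k3; exact: leq_trans M1M.
have nc s : s < 4 -> s != 2 -> V 0 s != V 1 s.
  by move=> s4 s2; case: s s4 s2 => [|[|[|[|]]]] // _ _; exact: nc0.
have p2 a s : a < M -> s < 4 -> s != 2 -> V a s != V 0 2.
  by move=> aM s4 s2; rewrite -(k2 a aM); apply: (block_neq bV).
pose p := V 0 2.
have cc a b a' b' s t : a < M -> b < M -> a' < M -> b' < M -> s < 4 -> t < 4 ->
    same_order a b a' b' -> col3 chi (V a s) (V b t) p = col3 chi (V a' s) (V b' t) p.
  move=> aM bM a'M b'M s4 t4 o; rewrite /p -{1}(k2 b bM) -(k2 b' b'M).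
  by apply: (canon_col cV) => //; exact: same_order_eq.
have swap d' t t' r b b' e : t < 4 -> t' < 4 -> r < 4 -> t != 2 -> t' != 2 -> r != 2 ->
    cluster V d' t t' -> b < K -> b' < K -> e < K ->
    ((b < e) && (b' < e)) || ((e < b) && (e < b')) ->
    col3 chi (V b t) (V e r) p = col3 chi (V b' t') (V e r) p.
  move=> t4 t'4 r4 t2 t'2 r2 cl bK b'K eK side; apply/eqP/negPn/negP => ne.
  pose sh := if b < e then 0 else 1; pose e0 := if b < e then M1 * K else 0.
  have jK j : j < M1 -> j * K + K <= M1 * K by move=> jM; rewrite -mulSnr leq_mul2r jM orbT.
  have jkK j k : j < k -> j * K + K <= k * K by move=> jk; rewrite -mulSnr leq_mul2r jk orbT.
  have bounds j : j < M1 -> [/\ sh + j * K + b < M, sh + j * K + b' < M, e0 < M & e0 < M].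
    by move=> /jK h; rewrite /sh /e0; case: (b < e); split; lia.
  have sides j : j < M1 -> (if b < e then (sh + j * K + b < e0) && (sh + j * K + b' < e0)
      else (e0 < sh + j * K + b) && (e0 < sh + j * K + b')).
    by move=> /jK h; rewrite /sh /e0; case: (b < e) side; lia.
  suff bl : blocks chi d' (fun j => nth 0 [:: V (sh + j * K + b) t;
      V (sh + j * K + b') t'; V e0 r; V e0 2]) M1 by exact: hC1 Xc bl _.
  apply: (reblock cV M3 h2 _ _ _ _ t4 t'4 r4 (isT : 2 < 4) (b := b) (b' := b')
    (e := e) (c := e) (be := fun j => sh + j * K + b) (be' := fun j => sh + j * K + b')
    (ep := fun=> e0) (ga := fun=> e0) _ cl bounds).
  - exact: ltn_trans KM.
  - exact: ltn_trans KM.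
  - exact: ltn_trans KM.
  - exact: ltn_trans KM.
  - by rewrite (k2 e (ltn_trans eK KM)).
  - by move=> j k jk _; have := jkK j k jk; split; lia.
  - by move=> j /sides; rewrite /same_order; case h: (b < e) side => sd ?; split; lia.
  - move=> j jM; have [m1 m2 m3 _] := bounds j jM.
    have e0j : (e0 != sh + j * K + b) && (e0 != sh + j * K + b').
      by have := sides j jM; case: ifP; lia.
    have [q1 q2] : V e0 2 = V 0 2 /\ true by rewrite k2.
    rewrite q1; split.
    + by apply: (canon_neq cV) => //; [exact: nc|exact: nc|lia].
    + exact: p2.
    + by apply: (canon_neq cV) => //; [exact: nc|exact: nc|lia].
    + exact: p2.
    + exact: p2.
clear hC1 M1M MK.
have K2 : 2 < K by apply: leq_ltn_trans nK; lia.
have K0 : 0 < K by exact: leq_trans K2.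
have K1 : 1 < K by exact: leq_trans K2.
have cl01 : cluster V d 0 1 by apply/and4P; split; apply: h4.
pose E01 := col3 chi (V 0 0) (V 1 3) p; pose E10 := col3 chi (V 1 0) (V 0 3) p.
have x01 : col3 chi (V 0 1) (V 1 3) p = E01.
  by apply/esym; apply: (swap d); rewrite ?K0.
have x10 : col3 chi (V 1 1) (V 0 3) p = E10.
  by apply/esym; apply: (swap d); rewrite ?K0.
have Vn a s : a < n -> s < 4 -> V a s < N by move=> an; apply: h2; exact: nM.
(* If E01 = E10, the link of p is, up to clusters, a matching between slot 3 and
   slot u, where u is 0 or 1. Otherwise it is a half graph between the separated
   slots 0 and 3, and a tile of length 2 reverses the order of the block numbers
   of its two labels. *)
case: (E01 =P E10) => [eE|neE].
- have [u [u2 hu]] : exists u, u < 2 /\ col3 chi (V 0 u) (V 0 3) p != E01.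
    have := h3 0 i0; rewrite col3CA [X in _ != X]col3CA.
    case: (boolP (col3 chi (V 0 0) (V 0 3) p == E01)) => [/eqP e|ne]; last by exists 0.
    by rewrite e eq_sym; exists 1.
  have u4 : u < 4 by exact: ltn_trans u2 _.
  have un2 : u != 2 by rewrite ltn_eqF.
  have ncu := nc0 u u2.
  have gen a b : a < n -> b < n -> a != b -> col3 chi (V a u) (V b 3) p = E01.
    move=> an bn ab; case: (ltngtP a b) ab => // ab _.
      have -> : col3 chi (V a u) (V b 3) p = col3 chi (V 0 u) (V 1 3) p.
        by apply: cc => //; [exact: nM|exact: nM|exact: same_order_lt].
      by case: u u2 {hu u4 un2 ncu} => [|[|]].
    have -> : col3 chi (V a u) (V b 3) p = col3 chi (V 1 u) (V 0 3) p.
      by apply: cc => //; [exact: nM|exact: nM|exact: same_order_gt].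
    by rewrite eE; case: u u2 {hu u4 un2 ncu} => [|[|]].
  have inb a : a < n -> col3 chi (V a u) (V a 3) p != E01.
    by move=> an; have aM := nM a an; rewrite (cc a a 0 0) //; exact: same_order_eq.
  pose o01 := V 0 u < V 1 3.
  case: (o01 =P (V 0 3 < V 1 u)) => [same|sep].
  + have cl := canon_cluster cV M3 u4 (isT : 3 < 4) ncu nc3 same.
    pose sg (f o : nat) := if (V 0 u < V 0 3) == o01 then nth 0 [:: u; 3] o else nth 0 [:: 3; u] o.
    have sgE f o : o < 2 -> sg f o = u \/ sg f o = 3.
      by rewrite /sg; case: ifP; case: o => [|[|]] //=; [left|right|right|left].
    have clo s t : s = u \/ s = 3 -> t = u \/ t = 3 -> lto o01 (V 0 s) (V 1 t).
      by case/and4P: cl => ? ? ? ?; case=> ->; case=> ->.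
    apply: (@tiles2_count X hX n n23 small N chi Xc nat V sg (fun _ _ => o01) p (fun=> V 0 u < V 0 2)).
    * split=> [b b' f o f' o' bb b'n f2 oo f'2 o'2|b f o o' bn f2 oo o'2].
        have := clo _ _ (sgE f o oo) (sgE f' o' o'2).
        have s4 : sg f o < 4 by case: (sgE f o oo) => ->.
        have s4' : sg f' o' < 4 by case: (sgE f' o' o'2) => ->.
        rewrite -(canon_lto cV M3 o01 bb) //; last by apply: nM; exact: leq_trans b'n (leq_subr _ _).
        by clear; rewrite /lto; case: (o01) => ?; split; lia.
      have [-> ->] : o = 0 /\ o' = 1 by clear - oo o'2; lia.
      have bM : b < M by apply: nM; exact: leq_trans bn (leq_subr _ _).
      have e1 : (V b u < V b 3) = (V 0 u < V 0 3).
        by apply: (canon_lt cV) => //; exact: same_order_eq.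
      have e2 : V b u != V b 3 by apply: (block_neq bV) => //; rewrite ltn_eqF // (ltn_trans u2).
      by rewrite /sg; case: eqP => /= e3; clear - e1 e2 e3; split; lia.
    * move=> b f o bn f2 o2; have s4 : sg f o < 4 by case: (sgE f o o2) => ->.
      have sn2 : sg f o != 2 by case: (sgE f o o2) => ->.
      have e1 : (V b (sg f o) < V 0 2) = (V 0 u < V 0 2).
        apply: (cluster_side cV M3 k2 (isT : 2 < 4) s4 u4 (d := o01)) => //.
          by apply/and4P; split; apply: clo; try (left; done); exact: sgE.
        by apply: nM; exact: leq_trans bn (leq_subr _ _).
      have bn' := leq_trans bn (leq_subr _ _).
      have e2 := p2 b (sg f o) (nM b bn') s4 sn2.
      by split; [exact: Vn|exact: e1|rewrite -e1 (neq_gtn e2)].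
    * exact: h2.
    * move=> a f k f0 o0 l f1 o1 an f2 kl ln f02 o02 f12 o12 _ _.
      have {}an := leq_trans an (leq_subr _ _).
      have {}ln := leq_trans ln (leq_subr _ _).
      have kn := ltn_trans kl ln.
      have -> : col3 chi (V k (sg f0 o0)) (V l (sg f1 o1)) p = E01.
        case: (sgE f0 o0 o02) => ->; case: (sgE f1 o1 o12) => ->.
        - rewrite col3C (swap o01 u 3 u l l k) ?kl ?orbT // 1?col3C; try exact: ltn_trans nK.
          by rewrite gen // ltn_eqF.
        - by rewrite gen // ltn_eqF.
        - by rewrite col3C gen // gtn_eqF.
        - rewrite col3C -(swap o01 u 3 3 l l k) ?kl ?orbT //; try exact: ltn_trans nK.
          by rewrite gen // gtn_eqF.
      by rewrite /sg; case: ifP => _ /=; last rewrite col3C; exact: inb.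
  + pose sl f := if f == 0 then u else 3.
    pose sg (f o : nat) := sl ((f + o) %% 2).
    have slE f : sl f = u \/ sl f = 3 by rewrite /sl; case: ifP; [left|right].
    have sl4 f : sl f < 4 by case: (slE f) => ->.
    have sln2 f : sl f != 2 by case: (slE f) => ->.
    have slnc f : V 0 (sl f) != V 1 (sl f) by case: (slE f) => ->.
    apply: (@tiles2_count X hX n n23 small N chi Xc nat V sg
      (fun f f' => V 0 (sl f) < V 1 (sl f')) p (fun f => V 0 (sl f) < V 0 2)).
    * split=> [b b' f o f' o' bb b'n f2 oo f'2 o'2|b f o o' bn f2 oo o'2]; rewrite /sg.
        have b'M : b' < M by apply: nM; exact: leq_trans b'n (leq_subr _ _).
        have bM := ltn_trans bb b'M.
        rewrite [(V b' _ < _)](canon_gt cV M3) ?(ltn_eqF bb) //.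
        have -> // : (V b (sl ((f + o) %% 2)) < V b' (sl ((f' + o') %% 2))) =
           (V 0 (sl ((f + o) %% 2)) < V 1 (sl ((f' + o') %% 2))).
        by apply: (canon_lt cV) => //; exact: same_order_lt.
      have [-> ->] : o = 0 /\ o' = 1 by clear - oo o'2; lia.
      have bM : b < M by apply: nM; exact: leq_trans bn (leq_subr _ _).
      have e1 s t : s < 4 -> t < 4 -> (V b s < V b t) = (V 0 s < V 0 t).
        by move=> s4 t4; apply: (canon_lt cV) => //; exact: same_order_eq.
      rewrite !e1 //.
      have e2 : V 0 u != V 0 3 by apply: (block_neq bV); rewrite // ltn_eqF // (ltn_trans u2).
      have e3 := canon_separated cV M3 u4 (isT : 3 < 4) ncu nc3 sep.
      have e4 : (V 0 3 < V 0 u) = (V 0 3 < V 1 u).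
        by apply: (canon_separated cV M3) => // e; apply: sep; rewrite e.
      by clear - e2 e3 e4 sep f2; case: f f2 => [|[|]] // _; rewrite /sl /=; split; lia.
    * move=> b f o bn f2 o2; rewrite /sg; set s := sl _.
      have bM : b < M by apply: nM; exact: leq_trans bn (leq_subr _ _).
      have e1 : (V b s < V 0 2) = (V 0 s < V 0 2).
        rewrite -{1}(k2 b) //.
        by apply: (canon_lt cV) => //; [exact: sl4|exact: same_order_eq].
      have e2 := p2 b s bM (sl4 _) (sln2 _).
      by split; [apply: h2; rewrite ?sl4|exact: e1|rewrite -e1 (neq_gtn e2)].
    * exact: h2.
    * move=> a f k f0 o0 l f1 o1 an f2 kl ln f02 o02 f12 o12; rewrite /sg => -> ->.
      have {}an := leq_trans an (leq_subr _ _).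
      have {}ln := leq_trans ln (leq_subr _ _).
      have kn := ltn_trans kl ln.
      case: f f2 => [|[|]] // _; rewrite /sl /=.
        by rewrite (gen k l) ?inb // ltn_eqF.
      by rewrite col3C [X in _ != X]col3C (gen l k) ?inb // gtn_eqF.
- have sep : (V 0 0 < V 1 3) <> (V 0 3 < V 1 0).
    move=> same; have cl := canon_cluster cV M3 (isT : 0 < 4) (isT : 3 < 4) (nc0 0 isT) nc3 same.
    apply: neE; rewrite /E01 /E10.
    rewrite (cc 0 1 0 2 0 3 i0 i1 i0 M3 isT isT (same_order_lt (isT : 0 < 1) (isT : 0 < 2))).
    rewrite (swap _ 0 3 3 0 1 2 _ _ _ _ _ _ cl) // col3C.
    rewrite -(swap _ 0 3 3 2 2 1 _ _ _ _ _ _ cl) //.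
    by apply: cc => //; exact: same_order_gt.
  pose sl f := if f == 0 then 0 else 3.
  have sl4 f : sl f < 4 by rewrite /sl; case: ifP.
  have sln2 f : sl f != 2 by rewrite /sl; case: ifP.
  have slnc f : V 0 (sl f) != V 1 (sl f) by apply: nc.
  pose V' a (hs : nat * nat) := V (2 * a + hs.1) hs.2.
  pose sg (f o : nat) := (1 - o, sl ((f + o) %% 2)).
  apply: (@tiles2_count X hX n n23 small N chi Xc _ V' sg
      (fun f f' => V 0 (sl f) < V 1 (sl f')) p (fun f => V 0 (sl f) < V 0 2)).
  * split=> [b b' f o f' o' bb b'n f2 oo f'2 o'2|b f o o' bn f2 oo o'2]; rewrite /V' /sg.
      have b'M : 2 * b' + (1 - o') < M by clear - nM2 b'n o'2; lia.
      have bb' : 2 * b + (1 - o) < 2 * b' + (1 - o') by clear - bb; lia.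
      have bM := ltn_trans bb' b'M.
      rewrite /= [(V (2 * b' + _) _ < _)](canon_gt cV M3) ?(ltn_eqF bb') //.
      have -> // : (V (2 * b + (1 - o)) (sl ((f + o) %% 2)) <
            V (2 * b' + (1 - o')) (sl ((f' + o') %% 2))) =
         (V 0 (sl ((f + o) %% 2)) < V 1 (sl ((f' + o') %% 2))).
      by apply: (canon_lt cV) => //; exact: same_order_lt.
    have [-> ->] : o = 0 /\ o' = 1 by clear - oo o'2; lia.
    have bM : 2 * b < M by clear - nM2 bn; lia.
    have bM' : 2 * b + 1 < M by clear - nM2 bn; lia.
    have bb : 2 * b < 2 * b + 1 by rewrite addn1.
    have e1 s t : s < 4 -> t < 4 -> (V (2 * b) t < V (2 * b + 1) s) = (V 0 t < V 1 s).
      by move=> s4 t4; apply: (canon_lt cV) => //; exact: same_order_lt.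
    have e2 s t : s < 4 -> t < 4 -> s != 2 -> t != 2 ->
        (V (2 * b + 1) s < V (2 * b) t) = ~~ (V 0 t < V 1 s).
      move=> s4 t4 s2 t2; rewrite (canon_gt cV M3) ?e1 ?(ltn_eqF bb) //; exact: nc.
    rewrite /= subnn !addn0 subn0 e1 // e2 //.
    by clear - sep f2; case: f f2 => [|[|]] // _; rewrite /sl /=; split; lia.
  * move=> b f o bn f2 o2; rewrite /V' /sg /=; set s := sl _.
    have bM : 2 * b + (1 - o) < M by clear - nM2 bn; lia.
    have e1 : (V (2 * b + (1 - o)) s < V 0 2) = (V 0 s < V 0 2).
      rewrite -{1}(k2 _ bM).
      by apply: (canon_lt cV) => //; [exact: sl4|exact: same_order_eq].
    have e2 := p2 _ s bM (sl4 _) (sln2 _).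
    by split; [apply: h2; rewrite ?sl4|exact: e1|rewrite -e1 (neq_gtn e2)].
  * exact: h2.
  * move=> a f k f0 o0 l f1 o1 an f2 kl ln f02 o02 f12 o12; rewrite /V' /sg /= => -> ->.
    rewrite subnn subn0 !addn0.
    have c01 i j : i < j -> j < M -> col3 chi (V i 0) (V j 3) p = E01.
      by move=> ij jM; apply: cc; rewrite ?(ltn_trans ij jM) //; exact: same_order_lt.
    have c10 i j : i < j -> j < M -> col3 chi (V j 0) (V i 3) p = E10.
      by move=> ij jM; apply: cc; rewrite ?(ltn_trans ij jM) //; exact: same_order_gt.
    case: f f2 => [|[|]] // _; rewrite /sl /=.
      by rewrite c10 ?c01 //; try (clear - an ln kl nM2; lia); apply/eqP => /esym.
    by rewrite col3C [X in _ != X]col3C c01 ?c10 //; try (clear - an ln kl nM2; lia); apply/eqP.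
Qed.

End CommonVertex.

(** * Colors of triples not contained in a block *)

(* F is the color of three vertices (block number, slot), U i the slots that may
   be used in phase i. By [Fswap], a vertex may move within its cluster as long as
   some other vertex stays extreme, i.e. has a block number below, or above, those
   of the two others. Moving two vertices around an extreme one shows that the
   color with vertex i lowest equals the color with vertex j highest for i <> j,
   and these equalities connect all six cases. *)
Section MixedColors.
Variables (F : nat * nat -> nat * nat -> nat * nat -> bool) (K L : nat).
Variables (cl : nat -> nat -> Prop) (U : nat -> nat -> Prop) (t : nat -> nat).
Hypotheses (LK : L + 30 <= K).
Hypothesis FC : forall x y z, F x y z = F y x z.
Hypothesis FCA : forall x y z, F x y z = F x z y.
Hypothesis Fcanon : forall a b c a' b' c' s u r, a < K -> b < K -> c < K ->
  a' < K -> b' < K -> c' < K -> s < 4 -> u < 4 -> r < 4 ->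
  same_order a b a' b' -> same_order b c b' c' -> same_order a c a' c' ->
  F (a, s) (b, u) (c, r) = F (a', s) (b', u) (c', r).
Hypothesis Fswap : forall b b' e c u u' s r, b < K -> b' < K -> e < K -> c < K ->
  u < 4 -> u' < 4 -> s < 4 -> r < 4 -> cl u u' ->
  [&& b < e, b' < e & c < e] || [&& e < b, e < b' & e < c] ->
  (b, u) != (c, r) -> (b', u') != (c, r) ->
  F (e, s) (b, u) (c, r) = F (e, s) (b', u') (c, r).
Hypothesis clU : forall i s s', i < 3 -> U i s -> U i s' -> cl s s'.
Hypothesis U4 : forall i s, i < 3 -> U i s -> s < 4.
Hypothesis Ut : forall i, i < 3 -> U i (t i).

Lemma F_rot x y z : F x y z = F y z x.
Proof. by rewrite FC FCA. Qed.

Lemma mixed_color_move i j b b' e c c' u u' s r r' :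
  b < L + 25 -> b' < L + 25 -> e < L + 25 -> c < L + 25 -> c' < L + 25 ->
  i < 3 -> j < 3 -> s < 4 -> U i u -> U i u' -> U j r -> U j r' ->
  [&& b < e, b' < e, c < e & c' < e] || [&& e < b, e < b', e < c & e < c'] ->
  (b, u) != (c, r) -> (b', u') != (c', r') ->
  F (e, s) (b, u) (c, r) = F (e, s) (b', u') (c', r').
Proof.
move=> bL b'L eL cL c'L i3 j3 s4 Uu Uu' Ur Ur' side n1 n2.
have [u4 u'4 r4 r'4] : [/\ u < 4, u' < 4, r < 4 & r' < 4].
  by split; [exact: U4 Uu|exact: U4 Uu'|exact: U4 Ur|exact: U4 Ur'].
have c1 := clU i3 Uu Uu; have c2 := clU i3 Uu Uu'; have c3 := clU j3 Ur Ur'.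
have neq (x y z w : nat) : x != z -> (x, y) != (z, w) by move=> h; rewrite xpair_eqE negb_and h.
case/orP: side => /and4P[h1 h2 h3 h4].
- have sh x y z p q v : x < L + 25 -> y < L + 25 -> z < L + 25 -> p < 4 -> q < 4 -> v < 4 ->
      F (x, p) (y, q) (z, v) = F (x.+1, p) (y.+1, q) (z.+1, v).
    by move=> *; apply: Fcanon; rewrite /same_order; lia.
  rewrite sh // [RHS]sh //.
  have n1' : (b.+1, u) != (c.+1, r) by [].
  have n2' : (b'.+1, u') != (c'.+1, r') by [].
  rewrite (@Fswap b.+1 0 e.+1 c.+1 u u s r) ?(neq 0) //; try lia.
  rewrite FCA (@Fswap c.+1 c'.+1 e.+1 0 r r' s u) ?(neq _ _ 0) //; try lia.
  rewrite FCA (@Fswap 0 b'.+1 e.+1 c'.+1 u u' s r') ?(neq 0) //; lia.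
- have f1 : L + 29 != c by lia. have f2 : c != L + 29 by lia.
  have f3 : c' != L + 29 by lia. have f4 : L + 29 != c' by lia.
  rewrite (@Fswap b (L + 29) e c u u s r) ?(neq (L + 29)) //; try lia.
  rewrite FCA (@Fswap c c' e (L + 29) r r' s u) ?(neq _ _ (L + 29)) //; try lia.
  rewrite FCA (@Fswap (L + 29) b' e c' u u' s r') ?(neq (L + 29)) //; lia.
Qed.

Definition mixed_color := F (0, t 0) (1, t 1) (2, t 2).

Lemma mixed_color_shift x y z p q v : x < L + 20 -> y < L + 20 -> z < L + 20 ->
  p < 4 -> q < 4 -> v < 4 ->
  F (x, p) (y, q) (z, v) = F (x.+2, p) (y.+2, q) (z.+2, v).
Proof. by move=> *; apply: Fcanon; rewrite /same_order; lia. Qed.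

Lemma neq_fst (x y z w : nat) : x != z -> (x, y) != (z, w).
Proof. by move=> h; rewrite xpair_eqE negb_and h. Qed.

Let t4 i : i < 3 -> t i < 4. Proof. by move=> i3; apply: U4 (Ut i3). Qed.

Section Colors.
Variables (k0 k1 k2 s0 s1 s2 : nat).
Hypotheses (U0 : U 0 s0) (U1 : U 1 s1) (U2 : U 2 s2).
Hypotheses (n01 : (k0, s0) != (k1, s1)) (n12 : (k1, s1) != (k2, s2))
  (n02 : (k0, s0) != (k2, s2)).

Let s04 : s0 < 4. Proof. exact: U4 U0. Qed.
Let s14 : s1 < 4. Proof. exact: U4 U1. Qed.
Let s24 : s2 < 4. Proof. exact: U4 U2. Qed.

Lemma color_min0 : k0 < k1 -> k0 < k2 -> k0 < L + 18 -> k1 < L + 18 -> k2 < L + 18 ->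
  F (k0, s0) (k1, s1) (k2, s2) = mixed_color.
Proof.
move=> h1 h2 b0 b1 b2.
have -> : F (k0, s0) (k1, s1) (k2, s2) = F (k0, s0) (k0.+1, t 1) (k0.+2, t 2).
  by apply: (@mixed_color_move 1 2); first [assumption|exact: Ut|apply: neq_fst; lia|lia].
have -> : F (k0, s0) (k0.+1, t 1) (k0.+2, t 2) = F (0, s0) (1, t 1) (2, t 2).
  by apply: Fcanon; first [assumption|exact: t4|exact: same_order_lt|lia].
rewrite -F_rot [RHS]/mixed_color -[RHS]F_rot.
by apply: (@mixed_color_move 0 1); first [assumption|exact: t4|exact: Ut|apply: neq_fst; lia|lia].
Qed.

Lemma color_max2 : k0 < k2 -> k1 < k2 -> k0 < L + 18 -> k1 < L + 18 -> k2 < L + 18 ->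
  F (k0, s0) (k1, s1) (k2, s2) = mixed_color.
Proof.
move=> h1 h2 b0 b1 b2; rewrite mixed_color_shift //; try lia.
rewrite -F_rot.
have -> : F (k2.+2, s2) (k0.+2, s0) (k1.+2, s1) = F (k2.+2, s2) (0, t 0) (1, t 1).
  by apply: (@mixed_color_move 0 1); first [assumption|exact: Ut|apply: neq_fst; lia|lia].
have -> : F (k2.+2, s2) (0, t 0) (1, t 1) = F (2, s2) (0, t 0) (1, t 1).
  by apply: Fcanon; first [assumption|exact: t4|exact: same_order_lt|exact: same_order_gt|lia].
rewrite F_rot.
by apply: (@mixed_color_move 1 2); first [assumption|exact: t4|exact: Ut|apply: neq_fst; lia|lia].
Qed.

End Colors.

Section ColorsExtreme1.
Variables (k0 k1 k2 s0 s1 s2 : nat).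
Hypotheses (U0 : U 0 s0) (U1 : U 1 s1) (U2 : U 2 s2).
Hypotheses (n01 : (k0, s0) != (k1, s1)) (n12 : (k1, s1) != (k2, s2))
  (n02 : (k0, s0) != (k2, s2)).

Let s04 : s0 < 4. Proof. exact: U4 U0. Qed.
Let s14 : s1 < 4. Proof. exact: U4 U1. Qed.
Let s24 : s2 < 4. Proof. exact: U4 U2. Qed.
Let n20 : (k2, s2) != (k0, s0). Proof. by rewrite eq_sym. Qed.

Lemma color_max1 : k0 < k1 -> k2 < k1 -> k0 < L + 15 -> k1 < L + 15 -> k2 < L + 15 ->
  F (k0, s0) (k1, s1) (k2, s2) = mixed_color.
Proof.
move=> h1 h2 b0 b1 b2; rewrite mixed_color_shift //; try lia.
have -> : F (k0.+2, s0) (k1.+2, s1) (k2.+2, s2) = F (0, t 0) (k1.+2, s1) (1, t 2).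
  rewrite F_rot [RHS]F_rot.
  by apply: (@mixed_color_move 2 0); first [assumption|exact: Ut|apply: neq_fst; lia|lia].
by apply: color_min0; first [assumption|exact: Ut|apply: neq_fst; lia|lia].
Qed.

Lemma color_min1 : k1 < k0 -> k1 < k2 -> k0 < L + 15 -> k1 < L + 15 -> k2 < L + 15 ->
  F (k0, s0) (k1, s1) (k2, s2) = mixed_color.
Proof.
move=> h1 h2 b0 b1 b2.
have -> : F (k0, s0) (k1, s1) (k2, s2) = F (k1.+1, t 0) (k1, s1) (k1.+2, t 2).
  rewrite F_rot [RHS]F_rot.
  by apply: (@mixed_color_move 2 0); first [assumption|exact: Ut|apply: neq_fst; lia|lia].
by apply: color_max2; first [assumption|exact: Ut|apply: neq_fst; lia|lia].
Qed.

End ColorsExtreme1.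

Lemma mixed_colorE k0 k1 k2 s0 s1 s2 : U 0 s0 -> U 1 s1 -> U 2 s2 ->
  (k0, s0) != (k1, s1) -> (k1, s1) != (k2, s2) -> (k0, s0) != (k2, s2) ->
  k0 < L -> k1 < L -> k2 < L -> ~~ ((k0 == k1) && (k1 == k2)) ->
  F (k0, s0) (k1, s1) (k2, s2) = mixed_color.
Proof.
move=> U0 U1 U2 n01 n12 n02 b0 b1 b2 nk.
have s04 : s0 < 4 by exact: U4 U0.
have s14 : s1 < 4 by exact: U4 U1.
have s24 : s2 < 4 by exact: U4 U2.
have : [|| (k0 < k1) && (k0 < k2), (k1 < k0) && (k2 < k0), (k1 < k0) && (k1 < k2),
   (k0 < k1) && (k2 < k1), (k2 < k0) && (k2 < k1) | (k0 < k2) && (k1 < k2)] by clear - nk; lia.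
case/or4P => [/andP[h1 h2]|/andP[h1 h2]|/andP[h1 h2]|].
- by apply: color_min0; first [assumption|lia].
- rewrite mixed_color_shift //; try lia.
  have -> : F (k0.+2, s0) (k1.+2, s1) (k2.+2, s2) = F (k0.+2, s0) (0, t 1) (1, t 2).
    by apply: (@mixed_color_move 1 2); first [assumption|exact: Ut|apply: neq_fst; lia|lia].
  by apply: color_min1; first [assumption|exact: Ut|apply: neq_fst; lia|lia].
- by apply: color_min1; first [assumption|lia].
- case/or3P => /andP[h1 h2].
  + by apply: color_max1; first [assumption|lia].
  + have -> : F (k0, s0) (k1, s1) (k2, s2) = F (k2.+1, t 0) (k2.+2, t 1) (k2, s2).
      rewrite -F_rot -[RHS]F_rot.
      by apply: (@mixed_color_move 0 1); first [assumption|exact: Ut|apply: neq_fst; lia|lia].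
    by apply: color_max1; first [assumption|exact: Ut|apply: neq_fst; lia|lia].
  + by apply: color_max2; first [assumption|lia].
Qed.

End MixedColors.

Lemma arr_okP v c f o f' o' : arr_ok v c -> f < 3 -> o < 3 -> f' < 3 -> o' < 3 ->
  ordO v (arr c f o) (arr c f' o') = ordPhi v c ((f + o) %% 3) ((f' + o') %% 3) /\
  (o < o' -> ordE v (arr c f o) (arr c f o') = ordPhi v c ((f + o) %% 3) ((f + o') %% 3)).
Proof.
have mi k : k < 3 -> k \in iota 0 3 by rewrite mem_iota.
rewrite /arr_ok allsE => /allP h f3 o3 f'3 o'3.
have := h f (mi f f3); rewrite allsE => /allP {}h.
have := h o (mi o o3); rewrite allsE => /allP {}h.
have := h f' (mi f' f'3); rewrite allsE => /allP {}h.
have := h o' (mi o' o'3); case: eqP => // -> {}h; split=> // oo.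
by move: h; rewrite oo => /eqP.
Qed.

Lemma arrs_perm c f : c \in arrs -> f < 3 ->
  [:: arr c f 0; arr c f 1; arr c f 2] \in perms3.
Proof.
move=> cin f3.
have h : all (fun c => all (fun f => [:: arr c f 0; arr c f 1; arr c f 2] \in perms3)
  (iota 0 3)) arrs by vm_compute.
by have /allP := allP h c cin; apply; rewrite mem_iota.
Qed.

Lemma arr_lt3 c f o : c \in arrs -> f < 3 -> o < 3 -> arr c f o < 3.
Proof.
move=> cin f3 o3; have := arrs_perm cin f3; rewrite /perms3 !inE.
by case: o o3 => [|[|[|]]] // _; do ![case/orP] => /eqP[e0 e1 e2]; rewrite ?e0 ?e1 ?e2.
Qed.

Lemma arr_inj c f o o' : c \in arrs -> f < 3 -> o < 3 -> o' < 3 -> o != o' ->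
  arr c f o != arr c f o'.
Proof.
move=> cin f3 o3 o'3; have := arrs_perm cin f3; rewrite /perms3 !inE.
by case: o o3 => [|[|[|]]] // _; case: o' o'3 => [|[|[|]]] // _;
  do ![case/orP] => /eqP[e0 e1 e2]; rewrite ?e0 ?e1 ?e2.
Qed.

Lemma mem_cells x : x \in cells -> x.1 < 3 /\ x.2 < 3.
Proof.
move=> xin; have h : all (fun x => (x.1 < 3) && (x.2 < 3)) cells by [].
by have /andP := allP h x xin.
Qed.

Section LongBlocks.
Variables (X : set coloring) (hX : ideal X) (n : nat).
Hypotheses (n23 : 22 < n) (small : #|slice X n| < G n).

Lemma no_long_blocks : exists M, forall N (chi : coloring_on N) d V, X (Tagged coloring_on chi) ->
  blocks chi d V M -> False.
Proof.
have [M2 hC2] := no_blocks_common_vertex hX n23 small.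
suff [M hM] : exists M, forall N (chi : coloring_on N) d V, X (Tagged coloring_on chi) ->
    blocks chi d V M -> True -> False by exists M => N chi d V Xc bV; exact: hM Xc bV I.
apply: (@no_blocks_reduce X (fun _ _ => True)) => //.
pose K := n + 30; pose M := (M2 + 2) * K + 3.
have KM : K < M by rewrite /M mulnDl; lia.
have M2M : M2 <= M by rewrite /M /K; nia.
have MK : M2 * K + 2 * K <= M by rewrite /M mulnDl; lia.
have nK : n + 30 <= K by [].
exists M; clearbody M K; have M3 : 2 < M by clear - nK KM n23; lia.
have i0 : 0 < M by exact: leq_trans M3.
have i1 : 1 < M by exact: leq_trans M3.
have nM a : a < n -> a < M by move=> an; clear - an nK KM; lia.
split=> // N chi d V Xc bV cV _; have [_ h2 h3 h4] := bV.
have nc s : s < 4 -> V 0 s != V 1 s.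
  have nc0 s' : s' < 2 -> V 0 s' != V 1 s'.
    by move=> s2; have := h4 0 1 s' s' isT i1 s2 s2; rewrite /lto; clear; case: (d); lia.
  case: s => [|[|[|[|]]]] // _; try exact: nc0.
    apply/negP => /eqP /(canon_const cV M3 (isT : 2 < 4)) k2.
    apply: (hC2 N chi d V Xc (blocks_leq M2M bV)).
    by move=> j jM; apply: k2; exact: leq_trans M2M.
  apply/negP => /eqP /(canon_const cV M3 (isT : 3 < 4)) k3.
  apply: (hC2 N chi d _ Xc (blocks_swap (blocks_leq M2M bV))).
  by move=> j jM; apply: k3; exact: leq_trans M2M.
have inj a s b t : a < M -> b < M -> s < 4 -> t < 4 -> (a, s) != (b, t) -> V a s != V b t.
  move=> aM bM s4 t4; rewrite xpair_eqE; case: eqP => [->|/eqP ab _].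
    exact: block_neq bV bM s4 t4.
  by have /(_ ab) := canon_neq cV M3 aM bM s4 t4 (nc s s4) (nc t t4).
pose F (x y z : nat * nat) := col3 chi (V x.1 x.2) (V y.1 y.2) (V z.1 z.2).
have FC x y z : F x y z = F y x z by exact: col3C.
have FCA x y z : F x y z = F x z y by exact: col3CA.
have Fcanon a b c a' b' c' s u r : a < K -> b < K -> c < K ->
    a' < K -> b' < K -> c' < K -> s < 4 -> u < 4 -> r < 4 ->
    same_order a b a' b' -> same_order b c b' c' -> same_order a c a' c' ->
    F (a, s) (b, u) (c, r) = F (a', s) (b', u) (c', r).
  by move=> *; apply: (canon_col cV) => //; apply: ltn_trans KM.
have Fswap d' b b' e c t t' s r : b < K -> b' < K -> e < K -> c < K ->
    t < 4 -> t' < 4 -> s < 4 -> r < 4 -> cluster V d' t t' ->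
    [&& b < e, b' < e & c < e] || [&& e < b, e < b' & e < c] ->
    (b, t) != (c, r) -> (b', t') != (c, r) ->
    F (e, s) (b, t) (c, r) = F (e, s) (b', t') (c, r).
  move=> bK b'K eK cK t4 t'4 s4 r4 cl side n1 n2; apply/eqP/negPn/negP => ne.
  pose sh := if b < e then 0 else 1; pose e0 := if b < e then M2 * K else 0.
  have jK j : j < M2 -> j * K + K <= M2 * K by move=> jM; rewrite -mulSnr leq_mul2r jM orbT.
  have jkK j k : j < k -> j * K + K <= k * K by move=> jk; rewrite -mulSnr leq_mul2r jk orbT.
  have bounds j : j < M2 -> [/\ sh + j * K + b < M, sh + j * K + b' < M, e0 < M
      & sh + j * K + c < M].
    move=> /jK h; clear - MK h bK b'K cK; rewrite /sh /e0; case: (b < e); split; lia.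
  have sides j : j < M2 -> (if b < e then
      [&& sh + j * K + b < e0, sh + j * K + b' < e0 & sh + j * K + c < e0]
      else [&& e0 < sh + j * K + b, e0 < sh + j * K + b' & e0 < sh + j * K + c]).
    by move=> /jK h; clear - side h bK b'K cK; rewrite /sh /e0; case: (b < e) side; lia.
  suff bl : blocks chi d' (fun j => nth 0 [:: V (sh + j * K + b) t;
      V (sh + j * K + b') t'; V e0 s; V (sh + j * K + c) r]) M2.
    exact: hC2 Xc bl _.
  apply: (reblock cV M3 h2 _ _ _ _ t4 t'4 s4 r4 (b := b) (b' := b')
    (e := e) (c := c) (be := fun j => sh + j * K + b) (be' := fun j => sh + j * K + b')
    (ep := fun=> e0) (ga := fun j => sh + j * K + c) _ cl bounds);
    try exact: ltn_trans KM.
  - by move: ne; rewrite FC [X in _ != X]FC.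
  - by move=> j k jk _; have := jkK j k jk; clear - bK b'K; split; lia.
  - move=> j /sides; clear - side; rewrite /same_order.
    by case h: (b < e) side => sd ?; split; lia.
  - move=> j jM; have [m1 m2 m3 m4] := bounds j jM.
    have [f1 f2 f3] : [/\ sh + j * K + b != e0, sh + j * K + b' != e0 & e0 != sh + j * K + c].
      by have := sides j jM; clear; case: ifP => _; split; lia.
    have ns (x y z w : nat) : (x, y) != (z, w) -> (sh + j * K + x, y) != (sh + j * K + z, w).
      by rewrite !xpair_eqE eqn_add2l.
    by split; apply: inj => //; first [exact: ns|exact: neq_fst].
have tr i s t : i < 2 -> s < 4 -> t < 4 -> V i s != V i.+1 t.
  move=> i2 s4 t4; apply: inj => //; rewrite ?neq_fst ?(ltn_eqF (ltnSn i)) //.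
    exact: ltn_trans M3.
  exact: leq_ltn_trans M3.
have cl01 : cluster V d 0 1 by apply/and4P; split; apply: h4.
have K2 : 2 < K by clear - nK n23; lia.
have K0 : 0 < K by exact: leq_trans K2.
have K1 : 1 < K by exact: leq_trans K2.
pose D := F (0, 0) (1, 2) (2, 3).
have D1 : F (0, 1) (1, 2) (2, 3) = D.
  by rewrite -(F_rot FC FCA) /D -[RHS](F_rot FC FCA); apply/esym; apply: (Fswap d).
have [u [u2 hu]] : exists u, u < 2 /\ col3 chi (V 0 u) (V 0 2) (V 0 3) != D.
  have := h3 0 i0; case: (boolP (col3 chi (V 0 0) (V 0 2) (V 0 3) == D)) => [/eqP ->|ne] h.
    by exists 1; rewrite eq_sym.
  by exists 0.
pose Z := nth 0 [:: u; 2; 3].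
have Z4 s : s < 3 -> Z s < 4.
  by case: s => [|[|[|]]] //= _; rewrite /Z /= (ltn_trans u2).
have Zinj s t : s < 3 -> t < 3 -> s != t -> Z s != Z t.
  by rewrite /Z; clear - u2; case: s => [|[|[|]]] //; case: t => [|[|[|]]] //=; lia.
have Du : F (0, Z 0) (1, Z 1) (2, Z 2) = D.
  by rewrite /Z /=; case: u u2 {hu Z Z4 Zinj} => [|[|]].
pose O x y := V 0 (Z x) < V 1 (Z y); pose E x y := V 0 (Z x) < V 0 (Z y).
pose v := [:: O 0 0; O 0 1; O 0 2; O 1 0; O 1 1; O 1 2; O 2 0; O 2 1; O 2 2;
              E 0 1; E 0 2; E 1 2].
have vO s t : s < 3 -> t < 3 -> ordO v s t = O s t.
  by case: s => [|[|[|]]] // _; case: t => [|[|[|]]].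
have EN s t : s < 3 -> t < 3 -> s != t -> ~~ E s t = E t s.
  move=> s3 t3 st; rewrite /E.
  have := inj 0 (Z s) 0 (Z t) i0 i0 (Z4 s s3) (Z4 t t3).
  rewrite xpair_eqE /= Zinj // => /(_ isT) ne; clear - ne; lia.
have vE s t : s < 3 -> t < 3 -> ordE v s t = E s t.
  case: s => [|[|[|]]] // _; case: t => [|[|[|]]] // _; rewrite /ordE /= ?EN //;
  by rewrite /E ltnn.
have vR x y : x.1 < 3 -> x.2 < 3 -> y.1 < 3 -> y.2 < 3 ->
    ordR v x y = (V x.1 (Z x.2) < V y.1 (Z y.2)).
  case: x y => [i s] [j t] /= i3 s3 j3 t3; rewrite /ordR /=.
  have iM : i < M := leq_trans i3 M3. have jM : j < M := leq_trans j3 M3.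
  case: (ltngtP i j) => ij.
  - by rewrite vO //; apply: (canon_lt cV); rewrite ?Z4 //; exact: same_order_lt.
  - rewrite vO // (canon_gt cV M3 jM iM) ?nc ?Z4 ?(ltn_eqF ij) //; congr (~~ _).
    by apply: (canon_lt cV); rewrite ?Z4 //; exact: same_order_lt.
  - by rewrite vE // ij; apply: (canon_lt cV); rewrite ?Z4 //; exact: same_order_eq.
have vok : order_ok v.
  rewrite /order_ok allsE; apply/allP => x /mem_cells[x1 x2].
  rewrite allsE; apply/allP => y /mem_cells[y1 y2].
  case: ifP => // xy; rewrite allsE; apply/allP => w /mem_cells[w1 w2].
  case: ifP => // yw; move: xy yw; rewrite !vR //; exact: ltn_trans.
have [c [cin cok]] := arr_exists (erefl : size v = 12) vok.
pose sg f o := Z (arr c f o).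
have sg4 f o : f < 3 -> o < 3 -> sg f o < 4 by move=> f3 o3; apply/Z4/arr_lt3.
pose Phi := ordPhi v c.
have sgO f o f' o' : f < 3 -> o < 3 -> f' < 3 -> o' < 3 ->
    (V 0 (sg f o) < V 1 (sg f' o')) = Phi ((f + o) %% 3) ((f' + o') %% 3).
  move=> f3 o3 f'3 o'3; rewrite /Phi; have [<- _] := arr_okP cok f3 o3 f'3 o'3.
  by rewrite vO ?arr_lt3.
have sgE f o o' : f < 3 -> o < o' -> o' < 3 ->
    (V 0 (sg f o) < V 0 (sg f o')) = Phi ((f + o) %% 3) ((f + o') %% 3).
  move=> f3 oo o'3; have o3 := ltn_trans oo o'3.
  rewrite /Phi; have [_ /(_ oo) <-] := arr_okP cok f3 o3 f3 o'3.
  by rewrite vE ?arr_lt3.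
have sgne f o o' : f < 3 -> o < o' -> o' < 3 -> sg f o != sg f o'.
  move=> f3 oo o'3; have o3 := ltn_trans oo o'3.
  by apply: Zinj; rewrite ?arr_lt3 ?arr_inj ?ltn_eqF.
have inb a f : a < n -> f < 3 ->
    col3 chi (V a (sg f 0)) (V a (sg f 1)) (V a (sg f 2)) != D.
  move=> an f3; have aM := nM a an.
  have -> : col3 chi (V a (sg f 0)) (V a (sg f 1)) (V a (sg f 2)) =
            col3 chi (V 0 (sg f 0)) (V 0 (sg f 1)) (V 0 (sg f 2)).
    by apply: (canon_col cV); rewrite ?sg4 //; exact: same_order_eq.
  have Sy x y z : col3 chi x y z = col3 chi y x z by exact: col3C.
  have Sz x y z : col3 chi x y z = col3 chi x z y by exact: col3CA.
  have := arrs_perm cin f3; rewrite /sg /perms3 !inE; move: hu; clear - Sy Sz.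
  rewrite -[u]/(Z 0) -{1}[2]/(Z 1) -{1}[3]/(Z 2) => hu.
  do ![case/orP] => /eqP[e0 e1 e2]; rewrite e0 e1 e2 //.
  - by rewrite Sz.
  - by rewrite Sy.
  - by rewrite Sz Sy.
  - by rewrite Sy Sz.
  - by rewrite Sy Sz Sy.
pose U i s := exists f o, [/\ f < 3, o < 3, (f + o) %% 3 = i & s = sg f o].
pose cl s t := exists d', cluster V d' s t.
have clU i s s' : i < 3 -> U i s -> U i s' -> cl s s'.
  move=> i3 [f [o [f3 o3 fo ->]]] [f' [o' [f'3 o'3 fo' ->]]].
  exists (Phi i i); have lt x y : lto (x < y) x y || (x == y).
    by rewrite /lto; clear; case: (ltngtP x y).
  have lo x y x' y' : x < 3 -> y < 3 -> x' < 3 -> y' < 3 -> (x + y) %% 3 = i ->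
      (x' + y') %% 3 = i -> lto (Phi i i) (V 0 (sg x y)) (V 1 (sg x' y')).
    move=> x3 y3 x'3 y'3 h h'; have := lt (V 0 (sg x y)) (V 1 (sg x' y')).
    by rewrite (negPf (tr 0 _ _ isT _ _)) ?sg4 // orbF sgO // h h'.
  by apply/and4P; split; apply: lo.
have U4 i s : i < 3 -> U i s -> s < 4 by move=> _ [f [o [f3 o3 _ ->]]]; exact: sg4.
have Ut i : i < 3 -> U i (sg 0 i) by move=> i3; exists 0, i; rewrite add0n modn_small.
have Fswap' b b' e c' t t' s r : b < K -> b' < K -> e < K -> c' < K ->
    t < 4 -> t' < 4 -> s < 4 -> r < 4 -> cl t t' ->
    [&& b < e, b' < e & c' < e] || [&& e < b, e < b' & e < c'] ->
    (b, t) != (c', r) -> (b', t') != (c', r) ->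
    F (e, s) (b, t) (c', r) = F (e, s) (b', t') (c', r).
  by move=> bK b'K eK cK t4 t'4 s4 r4 [d' hd]; apply: (Fswap d').
have gc := @mixed_colorE F K n cl U (sg 0) nK FC FCA Fcanon Fswap' clU U4 Ut.
have gD : mixed_color F (sg 0) = D.
  have neq3 (x y z w : nat) : x != z -> (x, y) != (z, w) by exact: neq_fst.
  have gc' k0 k1 k2 : k0 < n -> k1 < n -> k2 < n -> k0 != k1 -> k1 != k2 -> k0 != k2 ->
      F (k0, sg 0 0) (k1, sg 0 1) (k2, sg 0 2) = mixed_color F (sg 0).
    move=> h0 h1 h2' e01 e12 e02.
    by apply: gc; rewrite ?neq3 ?(negPf e01) //; exact: Ut.
  have [n0 n1 n2] : [/\ 0 < n, 1 < n & 2 < n] by clear - n23; split; lia.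
  rewrite -Du; have := arrs_perm cin (isT : 0 < 3); rewrite /perms3 !inE.
  rewrite /sg in gc' *.
  do ![case/orP] => /eqP[e0 e1 e2]; rewrite e0 e1 e2 in gc'.
  - by rewrite -(gc' 0 1 2).
  - by rewrite -(gc' 0 2 1) // FCA.
  - by rewrite -(gc' 1 0 2) // FC.
  - by rewrite -(gc' 1 2 0) // FCA FC.
  - by rewrite -(gc' 2 0 1) // FC FCA.
  - by rewrite -(gc' 2 1 0) // FC FCA FC.
apply: (@tiles3_count X hX n n23 small N chi Xc nat V sg Phi).
- split=> [b b' f o f' o' bb b'n f3 o3 f'3 o'3|b f o o' bn f3 oo o'3].
    have b'M := nM b' b'n; have bM := ltn_trans bb b'M.
    rewrite [(V b' _ < _)](canon_gt cV M3) ?(ltn_eqF bb) ?nc ?sg4 //.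
    rewrite -sgO //; have -> // : (V b (sg f o) < V b' (sg f' o')) = (V 0 (sg f o) < V 1 (sg f' o')).
    by apply: (canon_lt cV); rewrite ?sg4 //; exact: same_order_lt.
  have bM := nM b bn; have o3 := ltn_trans oo o'3.
  have ne : V b (sg f o) != V b (sg f o').
    by apply: inj; rewrite ?sg4 // xpair_eqE negb_and sgne ?orbT.
  rewrite (neq_gtn ne) -sgE //.
  have -> // : (V b (sg f o) < V b (sg f o')) = (V 0 (sg f o) < V 0 (sg f o')).
  by apply: (canon_lt cV); rewrite ?sg4 //; exact: same_order_eq.
- by move=> b f o bn f3 o3; apply: h2; rewrite ?sg4 ?nM.
- move=> a f k f0 o0 l f1 o1 q f2 o2 an f3 kl lq kq qn f03 o03 f13 o13 f23 o23 e0 e1 e2.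
  suff -> : col3 chi (V k (sg f0 o0)) (V l (sg f1 o1)) (V q (sg f2 o2)) = D by exact: inb.
  have step x y g h w z : g < 3 -> w < 3 -> h < 3 -> z < 3 ->
      x < y \/ [/\ x = y, g = h & w < z] -> (x, sg g w) != (y, sg h z).
    move=> g3 w3 h3' z3 [xy|[-> <- wz]]; first by rewrite neq_fst ?ltn_eqF.
    by rewrite xpair_eqE eqxx /= sgne.
  have kn := ltn_trans kq qn.
  have ln : l < n by case: lq => [lq|[-> _ _]] //; exact: ltn_trans qn.
  have n1 : (k, sg f0 o0) != (l, sg f1 o1) by exact: step.
  have n2 : (l, sg f1 o1) != (q, sg f2 o2) by exact: step.
  have n3 : (k, sg f0 o0) != (q, sg f2 o2) by rewrite neq_fst ?ltn_eqF.
  have Uk : U (f %% 3) (sg f0 o0) by exists f0, o0; rewrite e0 modn_small.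
  have Ul : U ((f + 1) %% 3) (sg f1 o1) by exists f1, o1.
  have Uq : U ((f + 2) %% 3) (sg f2 o2) by exists f2, o2.
  rewrite -gD -/(F (k, sg f0 o0) (l, sg f1 o1) (q, sg f2 o2)).
  case: f f3 Uk Ul Uq {e0 e1 e2} => [|[|[|]]] // _ Uk Ul Uq.
  + by apply: gc => //; clear - kq; lia.
  + rewrite -(F_rot FC FCA); apply: gc; rewrite // 1?eq_sym //.
    by clear - kq; lia.
  + rewrite (F_rot FC FCA); apply: gc; rewrite // 1?eq_sym //.
    by clear - kq; lia.
Qed.

End LongBlocks.

(** * Colorings with few breaks *)

Section Breaks.
Variables (N : nat) (chi : coloring_on N).

Definition break (i a b : nat) :=
  uniq [:: i; i.+1; a; b] && (col3 chi i a b != col3 chi i.+1 a b).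

Definition breaks : {set 'I_N} := finset (fun i : 'I_N =>
  (i.+1 < N) && [exists a : 'I_N, [exists b : 'I_N, break i a b]]).

Lemma breaks_blocks M : 2 * M < #|breaks| -> exists V, blocks chi true V M.
Proof.
move=> hM; pose s := [seq val i | i <- enum breaks].
have zs : size s = #|breaks| by rewrite size_map -cardE.
have srt : sorted ltn s.
  apply: (subseq_sorted ltn_trans _ (iota_ltn_sorted 0 N)).
  by rewrite -val_enum_ord; apply: map_subseq; rewrite enumT; exact: filter_subseq.
have hs i : i \in s -> i.+1 < N /\ exists ab, [/\ ab.1 < N, ab.2 < N & break i ab.1 ab.2].
  case/mapP => j; rewrite mem_enum inE => /andP[jN /existsP[a /existsP[b h]]] ->.
  by split=> //; exists (val a, val b); split=> /=.
have /choice[w hw] : forall i, exists ab : nat * nat, i \in s ->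
    [/\ ab.1 < N, ab.2 < N & break i ab.1 ab.2].
  move=> i; case: (boolP (i \in s)) => [/hs[_ [ab h]]|_]; first by exists ab.
  by exists (0, 0).
pose x j := nth 0 s (2 * j).
have xs j : j < M -> x j \in s by move=> jM; rewrite mem_nth // zs; lia.
have xS j k : j < k -> k < M -> (x j).+1 < x k.
  move=> jk kM.
  have lt a b : a < b -> b < size s -> nth 0 s a < nth 0 s b.
    by move=> ab bs; apply: (sorted_ltn_nth ltn_trans) => //; rewrite inE // (ltn_trans ab).
  have h1 : nth 0 s (2 * j) < nth 0 s (2 * j).+1 by apply: lt; rewrite ?zs; lia.
  have h2 : nth 0 s (2 * j).+1 < nth 0 s (2 * k) by apply: lt; rewrite ?zs; lia.
  exact: leq_ltn_trans h1 h2.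
exists (fun j => nth 0 [:: x j; (x j).+1; (w (x j)).1; (w (x j)).2]); split.
- by move=> j /xs /hw[_ _ /andP[]].
- move=> j t /xs xin; have [h0 _] := hs _ xin; have [h1 h2 _] := hw _ xin.
  by case: t => [|[|[|[|]]]] //= _; exact: ltnW.
- by move=> j /xs /hw[_ _ /andP[]].
- move=> j k t t' jk kM; have := xS j k jk kM.
  by case: t => [|[|]] //; case: t' => [|[|]] //= h _ _; rewrite /lto; lia.
Qed.

Lemma break_step i a b : i.+1 < N -> a < N -> b < N ->
  (forall j : 'I_N, val j = i -> j \notin breaks) -> uniq [:: i; i.+1; a; b] ->
  col3 chi i a b = col3 chi i.+1 a b.
Proof.
move=> iN aN bN ni u; apply/eqP/negPn/negP => ne.
have := ni (Ordinal (ltnW iN)) erefl; rewrite inE /= iN /= => /negP; apply.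
apply/existsP; exists (Ordinal aN); apply/existsP; exists (Ordinal bN).
by rewrite /break u ne.
Qed.

Lemma break_slide x y a b : x <= y -> y < N -> a < N -> b < N ->
  (forall j : 'I_N, x <= j < y -> j \notin breaks) ->
  a != b -> ~~ (x <= a <= y) -> ~~ (x <= b <= y) ->
  col3 chi x a b = col3 chi y a b.
Proof.
move=> xy yN aN bN; elim: y xy yN => [|y IH] xy yN nb ab na nb'.
  by move: xy; rewrite leqn0 => /eqP ->.
case: (ltngtP x y.+1) xy => // [xy|->] _ //.
rewrite IH; try lia; last by move=> j hj; apply: nb; lia.
apply: break_step => //; first by move=> j e; apply: nb; rewrite e; lia.
rewrite /= !inE; lia.
Qed.

(* For B = [breaks chi], the index of the interval of a in the partition of the
   vertex set at the breaks. *)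
Definition cell (B : {set 'I_N}) (a : nat) := #|finset (fun i : 'I_N => (i \in B) && (i < a))|.

Lemma cell_break B a b (j : 'I_N) : a <= b -> cell B a = cell B b -> a <= j < b -> j \notin B.
Proof.
move=> ab e /andP[aj jb]; apply/negP => jB.
have : cell B a < cell B b; last by rewrite e ltnn.
apply: proper_card; apply/fintype.properP; split.
  by apply/fintype.subsetP => i; rewrite !inE => /andP[-> /= ia]; exact: leq_trans ab.
by exists j; rewrite !inE jB //= -leqNgt.
Qed.

Lemma cell_color a b c a' b' c' : a < b -> b < c -> c < N -> a' < b' -> b' < c' -> c' < N ->
  cell breaks a = cell breaks a' -> cell breaks b = cell breaks b' ->
  cell breaks c = cell breaks c' -> col3 chi a b c = col3 chi a' b' c'.
Proof.
have low x y z x' y' z' : x < y -> y < z -> z < N -> x' < y' -> y' < z' -> x' <= x ->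
    y' <= y -> z' <= z -> cell breaks x' = cell breaks x -> cell breaks y' = cell breaks y ->
    cell breaks z' = cell breaks z -> col3 chi x y z = col3 chi x' y' z'.
  move=> xy yz zN xy' yz' xx yy zz ex ey ez.
  rewrite -(@break_slide x' x y z); try lia; last by move=> j; exact: cell_break.
  rewrite col3C -(@break_slide y' y x' z); try lia; last by move=> j; exact: cell_break.
  rewrite col3C col3CA col3C -(@break_slide z' z x' y'); try lia; last by move=> j; exact: cell_break.
  by rewrite col3C col3CA.
move=> ab bc cN ab' bc' cN' ea eb ec.
rewrite (@low a b c (minn a a') (minn b b') (minn c c')); try lia.
- rewrite -(@low a' b' c' (minn a a') (minn b b') (minn c c')) //; try lia.
  + by case: (leqP a a').
  + by case: (leqP b b').
  + by case: (leqP c c').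
- by case: (leqP a a').
- by case: (leqP b b').
- by case: (leqP c c').
Qed.

End Breaks.

Lemma cell_leq N (B : {set 'I_N}) a : cell B a <= #|B|.
Proof. by apply: subset_leq_card; apply/fintype.subsetP => i; rewrite !inE => /andP[]. Qed.

Lemma card_few_breaks (n K : nat) (A : {set coloring_on n}) : 0 < n ->
  (forall chi, chi \in A -> #|breaks chi| <= K) ->
  #|A| <= n ^ K * 2 ^ (K.+1 * K.+1 * K.+1).
Proof.
case: n A => // n A _ hK.
pose T := ({ffun 'I_K -> 'I_n.+1} * {ffun 'I_K.+1 * 'I_K.+1 * 'I_K.+1 -> bool})%type.
pose code (chi : coloring_on n.+1) : T :=
  ([ffun i : 'I_K => nth ord_max (enum (breaks chi)) i],
   [ffun p : 'I_K.+1 * 'I_K.+1 * 'I_K.+1 => [exists a : 'I_n.+1, exists b : 'I_n.+1,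
      exists c : 'I_n.+1, [&& a < b, b < c, cell (breaks chi) a == p.1.1,
        cell (breaks chi) b == p.1.2, cell (breaks chi) c == p.2 & col3 chi a b c]]]).
suff inj : {in A &, injective code}.
  rewrite -(card_in_imset inj) (leq_trans (max_card _)) //.
  by rewrite card_prod !card_ffun !card_prod !card_ord card_bool.
have brk chi x : chi \in A -> (x \in breaks chi) =
    (x.+1 < n.+1) && [exists i : 'I_K, (code chi).1 i == x].
  move=> /hK; rewrite cardE => zK; apply/idP/andP => [xin|[xn /existsP[i]]].
    split; first by move: xin; rewrite inE => /andP[].
    have ix : index x (enum (breaks chi)) < K.
      by apply: leq_trans zK; rewrite index_mem mem_enum.
    apply/existsP; exists (Ordinal ix); rewrite ffunE /= nth_index ?mem_enum //.
  rewrite ffunE; case: (ltnP i (size (enum (breaks chi)))) => [h /eqP <-|h].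
    by rewrite -mem_enum mem_nth.
  by rewrite nth_default // => /eqP e; move: xn; rewrite -e /= ltnn.
have colE chi a b c : chi \in A -> a < b -> b < c -> c < n.+1 ->
    forall (i j k : 'I_K.+1), val i = cell (breaks chi) a -> val j = cell (breaks chi) b ->
    val k = cell (breaks chi) c -> (code chi).2 (i, j, k) = col3 chi a b c.
  move=> cA ab bc cn i j k ei ej ek; rewrite ffunE /=; apply/idP/idP.
    case/existsP => a' /existsP[b' /existsP[c' /and5P[ab' bc' /eqP ea /eqP eb /andP[/eqP ec col]]]].
    suff -> : col3 chi a b c = col3 chi a' b' c' by [].
    by apply: cell_color; rewrite ?ea ?eb ?ec //; exact: ltn_ord.
  move=> col; have bn := ltn_trans bc cn; have an := ltn_trans ab bn.
  apply/existsP; exists (Ordinal an); apply/existsP; exists (Ordinal bn).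
  by apply/existsP; exists (Ordinal cn); rewrite /= ab bc ei ej ek !eqxx col.
clearbody code; move=> chi chi' cA cA' e.
have eB : breaks chi = breaks chi' by apply/setP => x; rewrite !brk // e.
apply: col3_ext => a b c ab bc cn.
have lt x : cell (breaks chi) x < K.+1 by rewrite ltnS (leq_trans (cell_leq _ _)) ?hK.
rewrite -(colE chi a b c cA ab bc cn (Ordinal (lt a)) (Ordinal (lt b)) (Ordinal (lt c))) //.
by rewrite e; apply: (colE chi' a b c cA' ab bc cn); rewrite -eB.
Qed.

Lemma card_slice1 (X : set coloring) : #|slice X 1| <= 1.
Proof.
suff /subset_leq_card : slice X 1 \subset finset.set1 ([ffun=> ord0] : coloring_on 1).
  by rewrite cards1.
apply/fintype.subsetP => chi _; rewrite inE; apply/eqP; apply: col3_ext.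
by move=> a b c ab bc cn; lia.
Qed.

Lemma slice_polynomial (X : set coloring) (n0 : nat) : ideal X -> 22 < n0 ->
  #|slice X n0| < G n0 -> exists e, forall n, 0 < n -> #|slice X n| <= n ^ e.+1.
Proof.
move=> hX n23 small; have [M hM] := no_long_blocks hX n23 small.
pose K := 2 * M; exists (K + (K.+1 * K.+1 * K.+1)).-1 => -[|[|n]] // _.
  by rewrite exp1n card_slice1.
have -> : (K + (K.+1 * K.+1 * K.+1)).-1.+1 = K + (K.+1 * K.+1 * K.+1).
  by rewrite prednK // !addnS.
apply: leq_trans (@card_few_breaks n.+2 K (slice X n.+2) isT _) _.
  move=> chi; rewrite inE => /asboolP Xc; rewrite leqNgt; apply/negP => /breaks_blocks[V bV].
  exact: hM Xc bV.
by rewrite expnD leq_mul2l leq_exp2r ?orbT.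
Qed.

Unset Implicit Arguments.
Local Open Scope ring_scope.
Import Order.TTheory GRing.Theory Num.Theory.

Theorem theorem1p2 (R : realType) (X : set coloring) (hX : ideal X) :
  exists c : R, 0 < c /\
    ((forall n : nat, (1 <= n)%N -> #|slice X n|%:R <= n%:R `^ c) \/
     (forall n : nat, (23 <= n)%N -> (G n <= #|slice X n|)%N)).
Proof.
have [h|] := pselect (forall n : nat, (23 <= n)%N -> (G n <= #|slice X n|)%N).
  by exists 1; split; [exact: ltr01|right].
move/existsNP => [n /not_implyP[n23 /negP]]; rewrite -ltnNge => small.
have [e he] := slice_polynomial hX n23 small.
exists e.+1%:R; split; first by rewrite ltr0n.
by left => m m0; rewrite powR_mulrn ?ler0n // -natrX ler_nat he.
Qed.
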